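(* Let $\underline{\mathbb{G}}=(\mathbb{G},\mathcal{V},\omega_{\mathcal{V}},\mathcal{F},\omega_{\mathcal{F}})$ be a packaged ribbon graph and $\Gamma$ a finite group whose irreducible representations have dimensions $n_1,\dots,n_k$. (1) For any edge $e$ of $\mathbb{G}$, \[q_\Gamma(\underline{\mathbb{G}}_\mathcal{V})=|\Gamma|^{2-\mu(e)}q_\Gamma((\underline{\mathbb{G}}/e)_\mathcal{V})-q_\Gamma((\underline{\mathbb{G}}\backslash e)_\mathcal{V}),\] and if $\mathbb{G}$ has no edges then $q_\Gamma(\underline{\mathbb{G}}_\mathcal{V})=\prod_{[v]\in\mathcal{V}}|\Gamma|^{-1}\sum_{i}n_i^{1+|[v]|-\omega_{\mathcal{V}}([v])}$. (2) For any edge $e$ of $\mathbb{G}$, \[p_\Gamma(\underline{\mathbb{G}}_\mathcal{F})=|\Gamma|^{2-\eta(e)}p_\Gamma((\underline{\mathbb{G}}\backslash e)_\mathcal{F})-p_\Gamma((\underline{\mathbb{G}}/e)_\mathcal{F}),\] and if $\mathbb{G}$ has no edges then $p_\Gamma(\underline{\mathbb{G}}_\mathcal{F})=\prod_{[f]\in\mathcal{F}}|\Gamma|^{-1}\sum_{i}n_i^{1+|[f]|-\omega_{\mathcal{F}}([f])}$. Here $|[a]|$ is the number of elements of the block $[a]$.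
   Context: All ribbon graphs are orientable. A ribbon graph $\mathbb{G}=(V,E)$ is an orientable surface with boundary formed as a union of discs $V$ (vertices) and discs $E$ (edges) meeting in disjoint arcs, each arc on the boundary of exactly one vertex and one edge, each edge containing two arcs; $v,e,f$ count vertices, edges, boundary components. $\mathbb{G}\backslash e$ removes $e$; $\mathbb{G}|A$ is the spanning ribbon subgraph on $A\subseteq E$, $A^c=E\setminus A$; $\mathbb{G}/e$ is obtained by attaching discs (new vertices) to the boundary curves of $e\cup u\cup v$ ($u,v$ ends of $e$) and removing $e,u,v$; $\mathbb{G}/A$ contracts all edges of $A$; boundary components of contractions correspond naturally to those of $\mathbb{G}$. The dual $\mathbb{G}^*$ has as vertices discs capping the boundary components of $\mathbb{G}$, same edges. A packaged ribbon graph $\underline{\mathbb{G}}=(\mathbb{G},\mathcal{V},\omega_{\mathcal{V}},\mathcal{F},\omega_{\mathcal{F}})$: $\mathcal{V}$ a partition of the vertex set, $\mathcal{F}$ a partition of the set of boundary components (equivalently of vertices of $\mathbb{G}^*$), weightings $\omega_{\mathcal{V}}:\mathcal{V}\to\mathbb{N}_0$, $\omega_{\mathcal{F}}:\mathcal{F}\to\mathbb{N}_0$; totals $\omega_{\mathcal{V}}(\mathbb{G}),\omega_{\mathcal{F}}(\mathbb{G})$. $\underline{\mathbb{G}}_\mathcal{V}=(\mathbb{G},\mathcal{V},\omega_{\mathcal{V}})$, $\underline{\mathbb{G}}_\mathcal{F}=(\mathbb{G},\mathcal{F},\omega_{\mathcal{F}})$. $\eta(e)$ is the number of blocks of $\mathcal{F}$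 containing a boundary component meeting $e$; $\mu(e)$ is the number of blocks of $\mathcal{V}$ containing an end of $e$. Deletion $\underline{\mathbb{G}}\backslash e$: ribbon graph $\mathbb{G}\backslash e$, $\mathcal{V},\omega_{\mathcal{V}}$ unchanged. (i) If $e$ meets one boundary component $f$, deletion creates $f',g'$ replacing $f$; $[f]$ becomes $([f]\setminus\{f\})\cup\{f',g'\}$ with weight $+1$. (ii) If $e$ meets $f\ne g$ with $[f]=[g]$, deletion creates $f'$; block becomes $([f]\setminus\{f,g\})\cup\{f'\}$ with weight $+1$. (iii) If $[f]\ne[g]$, blocks $[f],[g]$ replaced by $([f]\cup[g]\setminus\{f,g\})\cup\{f'\}$ with weight $\omega_{\mathcal{F}}([f])+\omega_{\mathcal{F}}([g])$. Contraction $\underline{\mathbb{G}}/e$: ribbon graph $\mathbb{G}/e$, $\mathcal{F},\omega_{\mathcal{F}}$ transported. (i) If $e$ is a loop at $u$, contraction creates $u',v'$ replacing $u$; $[u]$ becomes $([u]\setminus\{u\})\cup\{u',v'\}$ with weight $+1$. (ii) If $e$ has ends $u\ne v$, $[u]=[v]$, merged vertex $u'$; block becomes $([u]\setminus\{u,v\})\cup\{u'\}$ with weight $+1$. (iii) If $[u]\neq[v]$, blocks merged to $([u]\cup[v]\setminus\{u,v\})\cup\{u'\}$ with weight $\omega_{\mathcal{V}}([u])+\omega_{\mathcal{V}}([v])$. Other blocks/weights unchanged. Packaging: $G(\mathbb{G};\mathcal{V})$ has vertex set $\mathcal{V}$ and an edge $([u],[v])$ for each edge $(u,v)$ of $\mathbb{G}$;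 likewise $G(\mathbb{G}^*;\mathcal{F})$. For a subgraph $K$ of $G(\mathbb{G};\mathcal{V})$, $\mathbb{G}[K]$ is the ribbon subgraph with all vertices in blocks that are vertices of $K$ and edges corresponding to those of $K$, and $\underline{\mathbb{G}}_\mathcal{V}[K]=(\mathbb{G}[K],\mathcal{V}',\omega'_{\mathcal{V}})$ with restrictions; for a subgraph $H$ of $G(\mathbb{G}^*;\mathcal{F})$, $\underline{\mathbb{G}}_\mathcal{F}[H]=((\mathbb{G}^*[H])^*,\mathcal{F}',\omega'_{\mathcal{F}})$ with restrictions. If $G(\mathbb{G};\mathcal{V})$ is connected, $q^1_\Gamma(\underline{\mathbb{G}}_\mathcal{V})=|\Gamma|^{e(\mathbb{G})-|\mathcal{V}|}\sum_i n_i^{f(\mathbb{G})-e(\mathbb{G})+|\mathcal{V}|-\omega_{\mathcal{V}}(\mathbb{G})}$, otherwise the product of $q^1_\Gamma(\underline{\mathbb{G}}_\mathcal{V}[K])$ over components $K$; $q_\Gamma(\underline{\mathbb{G}}_\mathcal{V})=\sum_{A\subseteq E}(-1)^{|A^c|}q^1_\Gamma((\mathbb{G}|A,\mathcal{V},\omega_{\mathcal{V}}))$. If $G(\mathbb{G}^*;\mathcal{F})$ is connected, $p^1_\Gamma(\underline{\mathbb{G}}_\mathcal{F})=|\Gamma|^{e(\mathbb{G})-|\mathcal{F}|}\sum_i n_i^{v(\mathbb{G})-e(\mathbb{G})+|\mathcal{F}|-\omega_{\mathcal{F}}(\mathbb{G})}$, otherwise the product of $p^1_\Gamma(\underline{\mathbb{G}}_\mathcal{F}[H])$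 over components $H$; $p_\Gamma(\underline{\mathbb{G}}_\mathcal{F})=\sum_{A\subseteq E}(-1)^{|A^c|}p^1_\Gamma((\mathbb{G}/A^c,\mathcal{F},\omega_{\mathcal{F}}))$. These definitions apply to $\underline{\mathbb{G}}\backslash e$ and $\underline{\mathbb{G}}/e$ with their updated partitions and weights. *)

(* Defs.v *)
(* Orientable ribbon graphs are encoded as combinatorial maps
   (darts, vertex rotation sigma, edge involution alpha) plus a set of named
   isolated vertices. *)
From HB Require Import structures.
From mathcomp Require Import all_boot all_order all_algebra all_fingroup.
From mathcomp Require Import all_solvable all_field all_character.

Set Implicit Arguments.
Unset Strict Implicit.
Unset Printing Implicit Defensive.

Import Order.TTheory GRing.Theory Num.Theory.
Local Open Scope ring_scope.

Section RibbonGraphs.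
Variable D : finType.

(* A ribbon graph on the ambient dart type D:
   rS  = darts (half-edges) present; edges are the alpha-orbits {x, alpha x};
   rsg = vertex rotation (cyclic order of darts around each vertex disc);
   ral = fixed-point-free involution pairing the two darts of an edge;
   rI  = names of isolated vertices (discs without edges); each name is a
         nonempty set of darts not present in the graph. *)
Record rgraph := RG {
  rS : {set D};
  rsg : D -> D;
  ral : D -> D;
  rI : {set {set D}} }.

Definition wf_rg (G : rgraph) : Prop :=
  [/\ {in rS G &, injective (rsg G)},
      {in rS G, forall x, ral G x \in rS G},
      {in rS G, forall x, ral G (ral G x) = x /\ ral G x != x},
      {in rI G, forall N, N != set0 /\ [disjoint N & rS G]}
    & trivIset (rI G)] /\ {in rS G, forall x, rsg G x \in rS G}.

Definition vtx := ({set D} + {set D})%type.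

Definition vorbit (G : rgraph) (x : D) : {set D} := [set y | fconnect (rsg G) x y].

Definition verts (G : rgraph) : {set vtx} :=
  [set (inl (vorbit G x) : vtx) | x in rS G] :|: [set (inr N : vtx) | N in rI G].

Definition edges (G : rgraph) : {set {set D}} := [set [set x; ral G x] | x in rS G].

(* Dual ribbon graph: vertices = boundary components, given by sigma o alpha;
   an isolated vertex has one boundary component (the same name is used). *)
Definition dual (G : rgraph) : rgraph :=
  RG (rS G) (fun x => rsg G (ral G x)) (ral G) (rI G).

Definition faces (G : rgraph) : {set vtx} := verts (dual G).
Definition forbit (G : rgraph) (x : D) : {set D} := vorbit (dual G) x.

Definition frst (f : D -> D) (P : {set D}) (x : D) : D :=
  if x \in P then head x [seq y <- [seq iter k.+1 f x | k <- iota 0 #|D|] | y \in P]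
  else x.

(* deletion of all edges whose darts lie in X; a vertex all of whose darts are
   removed becomes an isolated vertex named by its former dart set *)
Definition del (G : rgraph) (X : {set D}) : rgraph :=
  RG (rS G :\: X) (frst (rsg G) (rS G :\: X)) (ral G)
     (rI G :|: [set vorbit G x | x in rS G & vorbit G x \subset X]).

Definition con (G : rgraph) (X : {set D}) : rgraph := dual (del (dual G) X).

(* natural correspondence of vertices of G with those of del G X (and of
   boundary components of G with those of con G X) *)
Definition vtrans (X : {set D}) (v : vtx) : vtx :=
  match v with
  | inl Ob => if Ob \subset X then inr Ob else inl (Ob :\: X)
  | inr N => inr N
  end.

Definition tpart (t : vtx -> vtx) (P : {set {set vtx}}) : {set {set vtx}} :=
  [set t @: B | B : {set vtx} in P].
Definition tweight (t : vtx -> vtx) (A : {set vtx}) (w : {set vtx} -> nat) :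
  {set vtx} -> nat := fun Y => w [set v in A | t v \in Y].

(* the update rule (i)/(ii)/(iii): the elements a, b (the boundary components
   met by e, resp. the ends of e) are replaced by the new elements N *)
Definition mrule (P : {set {set vtx}}) (w : {set vtx} -> nat) (a b : vtx)
    (N : {set vtx}) : {set {set vtx}} * ({set vtx} -> nat) :=
  let Ba := pblock P a in
  let Bb := pblock P b in
  let B' := ((Ba :|: Bb) :\: [set a; b]) :|: N in
  ((P :\: [set Ba; Bb]) :|: [set B'],
   fun Y => if Y == B' then (if Ba == Bb then (w Ba).+1 else w Ba + w Bb)
            else w Y).

Record pkg := Pkg {
  pG : rgraph;
  pV : {set {set vtx}};
  pwV : {set vtx} -> nat;
  pF : {set {set vtx}};
  pwF : {set vtx} -> nat }.

Definition wf_pkg (P : pkg) : Prop :=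
  [/\ wf_rg (pG P), partition (pV P) (verts (pG P))
    & partition (pF P) (faces (pG P))].

Definition edge_of (G : rgraph) (h : D) : {set D} := [set h; ral G h].

Definition pdel (P : pkg) (h : D) : pkg :=
  let G := pG P in
  let e := edge_of G h in
  let G' := del G e in
  let r := mrule (pF P) (pwF P) (inl (forbit G h)) (inl (forbit G (ral G h)))
                 (faces G' :\: faces G) in
  Pkg G' (tpart (vtrans e) (pV P)) (tweight (vtrans e) (verts G) (pwV P)) r.1 r.2.

Definition pcon (P : pkg) (h : D) : pkg :=
  let G := pG P in
  let e := edge_of G h in
  let G' := con G e in
  let r := mrule (pV P) (pwV P) (inl (vorbit G h)) (inl (vorbit G (ral G h)))
                 (verts G' :\: verts G) in
  Pkg G' r.1 r.2 (tpart (vtrans e) (pF P)) (tweight (vtrans e) (faces G) (pwF P)).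

Definition mu_e (P : pkg) (h : D) : nat :=
  let G := pG P in
  #|[set B in pV P | (inl (vorbit G h) \in B) || (inl (vorbit G (ral G h)) \in B)]|.
Definition eta_e (P : pkg) (h : D) : nat :=
  let G := pG P in
  #|[set B in pF P | (inl (forbit G h) \in B) || (inl (forbit G (ral G h)) \in B)]|.

Definition badj (G : rgraph) (P : {set {set vtx}}) : rel {set vtx} :=
  fun B1 B2 => [&& B1 \in P, B2 \in P &
    [exists x in rS G, (inl (vorbit G x) \in B1) && (inl (vorbit G (ral G x)) \in B2)]].

Definition comps (G : rgraph) (P : {set {set vtx}}) : {set {set {set vtx}}} :=
  [set [set B in P | connect (badj G P) B0 B] | B0 in P].

Definition connectedb (G : rgraph) (P : {set {set vtx}}) : bool := #|comps G P| == 1%N.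

Definition subg (G : rgraph) (K : {set {set vtx}}) : rgraph :=
  RG [set x in rS G | inl (vorbit G x) \in cover K] (rsg G) (ral G)
     [set N in rI G | inr N \in cover K].

Variables (gT : finGroupType) (Gam : {group gT}).

Definition ordG : algC := #|Gam|%:R.
Definition sumdeg (z : int) : algC := \sum_(i : Iirr Gam) ('chi[Gam]_i 1%g) ^ z.

Definition wtot (P : {set {set vtx}}) (w : {set vtx} -> nat) : nat := \sum_(B in P) w B.

Definition q1conn (G : rgraph) (P : {set {set vtx}}) (w : {set vtx} -> nat) : algC :=
  ordG ^ (#|edges G|%:Z - #|P|%:Z) *
  sumdeg (#|faces G|%:Z - #|edges G|%:Z + #|P|%:Z - (wtot P w)%:Z).

Definition q1 (G : rgraph) (P : {set {set vtx}}) (w : {set vtx} -> nat) : algC :=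
  if connectedb G P then q1conn G P w
  else \prod_(K in comps G P) q1conn (subg G K) K w.

Definition qG (G : rgraph) (P : {set {set vtx}}) (w : {set vtx} -> nat) : algC :=
  \sum_(A in powerset (edges G))
    let X := rS G :\: cover A in
    (-1) ^+ #|edges G :\: A| *
    q1 (del G X) (tpart (vtrans X) P) (tweight (vtrans X) (verts G) w).

Definition p1conn (G : rgraph) (P : {set {set vtx}}) (w : {set vtx} -> nat) : algC :=
  ordG ^ (#|edges G|%:Z - #|P|%:Z) *
  sumdeg (#|verts G|%:Z - #|edges G|%:Z + #|P|%:Z - (wtot P w)%:Z).

Definition p1 (G : rgraph) (P : {set {set vtx}}) (w : {set vtx} -> nat) : algC :=
  if connectedb (dual G) P then p1conn G P w
  else \prod_(H in comps (dual G) P) p1conn (dual (subg (dual G) H)) H w.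

Definition pG_ (G : rgraph) (P : {set {set vtx}}) (w : {set vtx} -> nat) : algC :=
  \sum_(A in powerset (edges G))
    let X := rS G :\: cover A in
    (-1) ^+ #|edges G :\: A| *
    p1 (con G X) (tpart (vtrans X) P) (tweight (vtrans X) (faces G) w).

End RibbonGraphs.

(* Main.v *)
Require Import Defs.
From HB Require Import structures.
From mathcomp Require Import all_boot all_order all_algebra all_fingroup.
From mathcomp Require Import all_solvable all_field all_character zify.
(* The second import of Defs restores [comps], [rgraph] and [subg], which
   MathComp shadows. *)
Import GRing.Theory Num.Theory Defs.
Local Open Scope ring_scope.

(** The state sum is split according to whether a state A contains e.  The
    states avoiding e are those of G \ e, with one extra sign.  For the states
    containing e, G|A and (G/e)|(A \ e) have the same numbers of boundary
    components and, up to the merged block, the same components; the changes in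
    the numbers of edges, blocks and weights are as in the update rules, which
    leaves the power 2 - mu(e) of the order of the group.

    Isolated vertices of G/e and of its subgraphs may receive different names
    depending on the order of the operations, so everything is expressed by data
    that do not see the names: the darts with the two permutations, the block of
    each dart, and the number of vertices and the weight of each block.  In these
    terms, contracting e = {x, y} replaces the rotation s by the first return
    map of [s \o tperm x y] to the darts outside e, and multiplication by a
    transposition changes the number of cycles by one.  The statement for p is
    the one for q applied to the dual graph. *)

Set Implicit Arguments.
Unset Strict Implicit.
Unset Printing Implicit Defensive.

(** * First return maps and cycle counts *)

(** The size of an image depends only on the kernel of the map: following a section [r] of [f1] by
    [f2] gives a bijection between the two images. The default [x0] is used only off the image of
    [f1]. *)
Lemma card_imset_ker (T T1 T2 : finType) (f1 : T -> T1) (f2 : T -> T2)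
    (A : {set T}) :
  {in A &, forall x y, (f1 x == f1 y) = (f2 x == f2 y)} ->
  #|f1 @: A| = #|f2 @: A|.
Proof.
move=> eqf.
have [->|[x0 x0A]] := set_0Vmem A; first by rewrite !imset0 !cards0.
pose r u := odflt x0 [pick x in A | f1 x == u].
have rP u : u \in f1 @: A -> r u \in A /\ f1 (r u) = u.
  case/imsetP=> x xA ->; rewrite /r; case: pickP => [y /andP[yA /eqP]//|].
  by move/(_ x); rewrite xA eqxx.
have -> : f2 @: A = (f2 \o r) @: (f1 @: A).
  apply/setP=> v; apply/imsetP/imsetP => [[x xA ->]|[u uA ->]].
    have fxA : f1 x \in f1 @: A by apply: imset_f.
    exists (f1 x) => //=; have [rA /eqP] := rP _ fxA.
    by rewrite eqf // => /eqP.
  by exists (r u) => //; case: (rP u uA).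
rewrite [RHS]card_in_imset // => u v /rP[uA ru] /rP[vA rv] /= /eqP.
by rewrite -eqf // ru rv => /eqP.
Qed.

Section FirstReturn.
Variable D : finType.
Implicit Types (f g : D -> D) (A S Q : {set D}) (x y z : D).

(** The maps of a ribbon graph are total on [D] but meaningful only on the darts present, hence
    permutations relative to a stable finite set. *)
Definition permutes f S : Prop :=
  {in S &, injective f} /\ {in S, forall x, f x \in S}.

(* [x] itself does not count as a visit to [Q]. *)
Inductive hits f Q x : D -> Prop :=
| hits_here : f x \in Q -> hits f Q x (f x)
| hits_later y : f x \notin Q -> hits f Q (f x) y -> hits f Q x y.

Lemma hits_fun f Q x y z : hits f Q x y -> hits f Q x z -> y = z.
Proof.
move=> h; elim: h z => {x y} [x fxQ|x y fxQ _ IH] z; last first.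
  case=> [fxQ'|z' _]; last exact: IH.
  by rewrite fxQ' in fxQ.
by case=> // z'; rewrite fxQ.
Qed.

Lemma hits_mem f Q x y : hits f Q x y -> y \in Q.
Proof. by elim. Qed.

Lemma hits_fconnect f Q x y : hits f Q x y -> fconnect f x y.
Proof.
elim=> {x y} [x _|x y _ _]; first exact: fconnect1.
exact/connect_trans/fconnect1.
Qed.

Lemma hits_iter f Q x n :
  (forall j, (j < n)%N -> iter j.+1 f x \notin Q) -> iter n.+1 f x \in Q ->
  hits f Q x (iter n.+1 f x).
Proof.
elim: n x => [|n IH] x nQ inQ; first exact: hits_here.
rewrite iterSr; apply: hits_later; first exact: (nQ 0%N).
apply: IH; last by rewrite -iterSr.
by move=> j ltjn; rewrite -iterSr; apply: nQ.
Qed.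

Lemma iter_in f S n : {in S, forall x, f x \in S} ->
  {in S, forall x, iter n f x \in S}.
Proof. by move=> fS x xS; elim: n => //= n; apply: fS. Qed.

Lemma fconnect_in f S x y :
  {in S, forall x, f x \in S} -> x \in S -> fconnect f x y -> y \in S.
Proof. by move=> fS xS /iter_findex <-; apply: iter_in. Qed.

(** Iterating a permutation brings [x] back to itself within [#|D|] steps, so the list searched by
    [frst] contains a visit to [Q] and the default of [head] is never returned. *)
Lemma frst_hits f S Q x : permutes f S -> Q \subset S -> x \in Q ->
  hits f Q x (frst f Q x).
Proof.
move=> [injf fS] QS xQ; rewrite /frst xQ.
have xS := subsetP QS _ xQ.
pose p n := iter n.+1 f x \in Q.
have ex_p : exists n, p n.
  exists (fingraph.order f x).-1; rewrite /p prednK ?order_gt0 //.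
  by rewrite (iter_order_in fS injf).
have pm : (ex_minn ex_p < #|D|)%N.
  case: ex_minnP => m _ min_m; apply: leq_ltn_trans (min_m (fingraph.order f x).-1 _) _.
    by rewrite /p prednK ?order_gt0 // (iter_order_in fS injf).
  by rewrite prednK ?order_gt0 // max_card.
case: ex_minnP pm => m pm min_m ltm.
have nQ j : (j < m)%N -> iter j.+1 f x \notin Q.
  by move=> ltj; apply/negP => /min_m; rewrite leqNgt ltj.
(* The list is cut at the first visit: its first [m] entries miss [Q] and are filtered out, so the
   next one becomes the head. *)
have -> : #|D| = (m + (#|D| - m.+1).+1)%N by rewrite addnS -addSn subnKC.
rewrite iotaD map_cat filter_cat add0n.
rewrite (@eq_in_filter _ _ pred0) ?filter_pred0 /=.
  by rewrite (pm : f (iter m f x) \in Q); apply: (@hits_iter _ _ _ m).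
move=> y /mapP[k]; rewrite mem_iota add0n => /andP[_ ltk] ->.
exact/negbTE/nQ.
Qed.

Lemma frst_eq f S Q x y : permutes f S -> Q \subset S -> x \in Q ->
  hits f Q x y -> frst f Q x = y.
Proof. by move=> pf QS xQ; apply/hits_fun/(frst_hits pf). Qed.

Lemma frst_mem f S Q x : permutes f S -> Q \subset S -> x \in Q ->
  frst f Q x \in Q.
Proof. by move=> pf QS xQ; apply/hits_mem/(frst_hits pf). Qed.

(** A start point matters only through its image, so [x] and [x'] may differ. After the first step
    the walk stays in [S :\: Q] until it ends, and there the two maps agree. *)
Lemma hits_congr f g S Q x x' y :
  {in S, forall z, f z \in S} -> {in S :\: Q, f =1 g} ->
  f x \in S -> f x = g x' -> hits f Q x y -> hits g Q x' y.
Proof.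
move=> fS eqfg + + h; elim: h x' => {x y} [x fxQ|x y fxQ _ IH] x' fxS fgx.
  by rewrite fgx; apply: hits_here; rewrite -fgx.
rewrite fgx in fxQ fxS IH *; apply: hits_later => //.
by apply: IH; [apply: fS | apply: eqfg; rewrite inE fxQ].
Qed.

Lemma permutes_eq f g S : {in S, f =1 g} -> permutes f S -> permutes g S.
Proof.
move=> eqfg [injf fS]; split=> [x y xS yS|x xS]; last first.
  by rewrite -eqfg ?fS.
by rewrite -!eqfg //; apply: injf.
Qed.

Lemma frst_congr f g S Q : permutes f S -> Q \subset S -> {in S, f =1 g} ->
  {in Q, frst f Q =1 frst g Q}.
Proof.
move=> pf QS eqfg x xQ; apply/esym/(frst_eq (permutes_eq eqfg pf)) => //.
have xS := subsetP QS _ xQ; have [injf fS] := pf.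
apply: (hits_congr fS _ (fS _ xS) (eqfg _ xS)) (frst_hits pf QS xQ).
by move=> z /setDP[zS _]; apply: eqfg.
Qed.

Lemma hits_ex f Q x y : hits f Q x y ->
  exists2 n, y = iter n.+1 f x & forall j, (j < n)%N -> iter j.+1 f x \notin Q.
Proof.
elim=> {x y} [x _|x y nQ _ [n -> IH]]; first by exists 0%N.
exists n.+1; first by rewrite [RHS]iterSr.
by case=> [|j] //; rewrite ltnS [iter j.+2 _ _]iterSr => /IH.
Qed.

(** If [x] and [y] have the same first return, after [n.+1] and [m.+1] steps with [n <= m],
    cancelling [n.+1] steps puts [x] on the walk from [y] after [m - n] steps. Unless [m = n], this
    is an earlier visit to [Q]. *)
Lemma permutes_frst f S Q : permutes f S -> Q \subset S ->
  permutes (frst f Q) Q.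
Proof.
move=> pf QS; split; last by move=> x; apply: (frst_mem pf).
have [injf fS] := pf.
have inj_iter n : {in S &, injective (iter n f)}.
  elim: n => [|n IH] x y xS yS //= /injf; rewrite !iter_in // => /(_ isT isT).
  exact: IH.
have key x y n m : x \in Q -> y \in Q -> (n <= m)%N ->
    iter n.+1 f x = iter m.+1 f y ->
    (forall j, (j < m)%N -> iter j.+1 f y \notin Q) -> x = y.
  move=> xQ yQ lenm; have [xS yS] := (subsetP QS _ xQ, subsetP QS _ yQ).
  rewrite -[in iter m.+1 f y](subnKC lenm) -addSn iterD => /inj_iter.
  rewrite iter_in // => /(_ xS isT) def_x nQ.
  case def_d: (m - n)%N def_x => [|d] // def_x.
  have /nQ: (d < m)%N by rewrite -def_d leq_subr.
  by rewrite -def_x xQ.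
move=> x y xQ yQ eqxy.
have [n defn nQ] := hits_ex (frst_hits pf QS xQ).
have [m defm mQ] := hits_ex (frst_hits pf QS yQ).
have eqit : iter n.+1 f x = iter m.+1 f y by rewrite -defn -defm.
case: (leqP n m) => [le|/ltnW le]; first exact: key eqit mQ.
by apply/esym/(key y x m n).
Qed.

(** The walk of [f] to [Q2] is cut into pieces by its visits to [Q1], and each piece is one step of
    the first return map to [Q1]. *)
Lemma frst_frst f S Q1 Q2 : permutes f S -> Q1 \subset S -> Q2 \subset Q1 ->
  {in Q2, frst (frst f Q1) Q2 =1 frst f Q2}.
Proof.
move=> pf Q1S Q21 x xQ2; have xQ1 := subsetP Q21 _ xQ2.
apply: (frst_eq (permutes_frst pf Q1S) Q21 xQ2).
have h := frst_hits pf (subset_trans Q21 Q1S) xQ2.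
have h1 := frst_hits pf Q1S xQ1.
(* The induction runs over all points [z] of the walk: [u] is the last point of [Q1] met so far, so
   [z] and [u] have the same next visit to [Q1]. *)
suff key z y u : hits f Q2 z y -> u \in Q1 -> hits f Q1 z (frst f Q1 u) ->
    hits (frst f Q1) Q2 u y by apply: key h1.
move=> {x xQ2 xQ1 h h1} h.
elim: h u => {z y} [z fzQ|z y fzQ _ IH] u uQ1 hu.
  have fz1 : f z = frst f Q1 u.
    exact: hits_fun (hits_here (subsetP Q21 _ fzQ)) hu.
  by rewrite fz1; apply: hits_here; rewrite -fz1.
have [fzQ1|fzQ1] := boolP (f z \in Q1).
  have fz1 : f z = frst f Q1 u by apply: hits_fun (hits_here fzQ1) hu.
  apply: hits_later; rewrite -fz1 //; apply: IH => //.
  exact: (frst_hits pf).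
apply: IH => //; case: hu fzQ1 => [->//|y' _ hu _]; exact: hu.
Qed.

Lemma fconnect_frst f S Q x y : permutes f S -> Q \subset S ->
  x \in Q -> y \in Q -> fconnect (frst f Q) x y = fconnect f x y.
Proof.
move=> pf QS xQ yQ; apply/idP/idP => [/iter_findex <-|].
  elim: (findex _ _ _) => [|n IH]; first exact: connect0.
  apply: (connect_trans IH).
  apply: (hits_fconnect (frst_hits pf QS _)).
  by apply: iter_in xQ; move=> z; apply: (frst_mem pf).
move=> /iter_findex; case: (findex _ _ _) => [<-|n def_y].
  exact: connect0.
(* Again [z] moves along the walk of [f], while [u] is the last point of [Q] behind it. *)
have key m u z : u \in Q -> hits f Q z (frst f Q u) -> iter m.+1 f z \in Q ->
    fconnect (frst f Q) u (iter m.+1 f z).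
  elim: m u z => [|m IH] u z uQ hu mQ.
    by rewrite (hits_fun (hits_here mQ) hu) fconnect1.
  rewrite iterSr in mQ *.
  have [fzQ|fzQ] := boolP (f z \in Q); last first.
    by apply: IH => //; case: hu fzQ => [->//|y' _ hu _]; exact: hu.
  have fz1 : f z = frst f Q u by apply: hits_fun (hits_here fzQ) hu.
  apply: (connect_trans (fconnect1 _ u)); rewrite -fz1.
  by apply: IH => //; apply: (frst_hits pf).
by rewrite -def_y in yQ *; apply: key => //; apply: (frst_hits pf).
Qed.

(** * Orbits and the number of cycles *)

Definition orb f x : {set D} := [set y | fconnect f x y].
Definition ncyc f (A : {set D}) : nat := #|[set orb f x | x in A]|.

Lemma orb_refl f x : x \in orb f x.
Proof. by rewrite inE connect0. Qed.

Lemma orb_sub f S x : {in S, forall x, f x \in S} -> x \in S -> orb f x \subset S.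
Proof. by move=> fS xS; apply/subsetP => y; rewrite inE => /(fconnect_in fS xS). Qed.

Lemma eq_orb f S : permutes f S ->
  {in S &, forall x y, (orb f x == orb f y) = (y \in orb f x)}.
Proof.
move=> [injf fS] x y xS yS; apply/eqP/idP => [->|]; first exact: orb_refl.
rewrite inE => xy; apply/setP=> z; rewrite !inE.
have yx : fconnect f y x by rewrite -(fconnect_sym_in fS injf).
by apply/idP/idP; apply: connect_trans.
Qed.

Lemma orb_congr f g A x : {in A, f =1 g} -> {in A, forall x, f x \in A} ->
  x \in A -> orb f x = orb g x.
Proof.
move=> eqfg fA xA; have eqit n : iter n f x = iter n g x.
  by elim: n => //= n <-; rewrite -eqfg // iter_in.
apply/setP=> y; rewrite !inE; apply/idP/idP => /iter_findex <-.
  by rewrite eqit fconnect_iter.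
by rewrite -eqit fconnect_iter.
Qed.

Lemma ncyc_congr f g S A : {in S, f =1 g} -> {in S, forall x, f x \in S} ->
  A \subset S -> ncyc f A = ncyc g A.
Proof.
move=> eqfg fS AS; rewrite /ncyc; congr #|(_ : {set {set D}})|.
apply: eq_in_imset => x xA; exact: orb_congr fS (subsetP AS _ xA).
Qed.

(** A walk that starts in a stable set [A] never leaves it, so its first visit to [Q] is its first
    visit to [A :&: Q]. *)
Lemma frst_restrict f S A Q : permutes f S -> A \subset S -> Q \subset S ->
  {in A, forall x, f x \in A} -> {in A :&: Q, frst f Q =1 frst f (A :&: Q)}.
Proof.
move=> pf AS QS fA x /setIP[xA xQ].
have AQA : A :&: Q \subset A by apply: subsetIl.
have pfA : permutes f A.
  by split=> // y z yA zA; apply: (proj1 pf); apply: (subsetP AS).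
apply/esym/(frst_eq pfA AQA); first by rewrite inE xA.
have h := frst_hits pf QS xQ.
elim: h xA => {x xQ} [x fxQ|x y fxQ _ IH] xA.
  by apply: hits_here; rewrite inE fxQ fA.
by apply: hits_later; [rewrite inE negb_and fxQ orbT | apply/IH/fA].
Qed.

Lemma orb_frst f S Q x : permutes f S -> Q \subset S -> x \in Q ->
  orb (frst f Q) x = orb f x :&: Q.
Proof.
move=> pf QS xQ; apply/setP=> y; rewrite !inE.
have [yQ|yQ] := boolP (y \in Q).
  by rewrite andbT (fconnect_frst pf).
rewrite andbF; apply: contraNF yQ; apply: fconnect_in => // z.
exact: (frst_mem pf).
Qed.

(** These are the cycles lost by passing to the first return map. When [Q] is the complement of an
    edge, they account for the vertices that become isolated. *)
Definition dead_orbits f A Q : {set {set D}} :=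
  [set O in [set orb f x | x in A] | [disjoint O & Q]].

(** Each cycle of [f] that meets [Q] leaves exactly one cycle of the first return map, namely its
    trace on [Q]. *)
Lemma ncyc_frst f A Q : permutes f A -> Q \subset A ->
  ncyc f A = (ncyc (frst f Q) Q + #|dead_orbits f A Q|)%N.
Proof.
move=> pf QA; have [_ fA] := pf.
have -> : ncyc (frst f Q) Q = ncyc f Q.
  apply: card_imset_ker => x y xQ yQ.
  rewrite (eq_orb (permutes_frst pf QA)) // inE (fconnect_frst pf) //.
  by rewrite (eq_orb pf) ?inE ?(subsetP QA).
rewrite /ncyc; have -> : [set orb f x | x in A] =
    [set orb f x | x in Q] :|: dead_orbits f A Q.
  apply/setP=> O; rewrite !inE; apply/idP/orP=> [OA|[|/andP[]//]]; last first.
    by case/imsetP=> x /(subsetP QA) xA ->; apply: imset_f.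
  rewrite OA /=; case/imsetP: OA => x xA ->.
  have [|/pred0Pn[y /andP[/= yO yQ]]] := boolP [disjoint _ & Q]; first by right.
  left; apply/imsetP; exists y => //.
  by apply/eqP; rewrite (eq_orb pf) // (subsetP QA).
rewrite cardsU [_ :&: _](_ : _ = set0) ?cards0 ?subn0 //.
apply/setP=> O; rewrite !inE; apply/negP=> /andP[/imsetP[x xQ ->]].
by case/andP=> _ /pred0P/(_ x); rewrite /= orb_refl xQ.
Qed.

(** A cycle disjoint from [Q] is traced entirely in [A :\: Q], where the two maps agree. *)
Lemma dead_orbits_congr f g A Q :
  {in A, forall x, f x \in A} -> {in A, forall x, g x \in A} ->
  {in A :\: Q, f =1 g} -> dead_orbits f A Q = dead_orbits g A Q.
Proof.
have sub f1 f2 : {in A, forall x, f1 x \in A} ->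
    {in A :\: Q, f1 =1 f2} -> dead_orbits f1 A Q \subset dead_orbits f2 A Q.
  move=> f1A eqf; apply/subsetP=> O; rewrite !inE.
  case/andP=> /imsetP[x xA ->] disj.
  suff -> : orb f1 x = orb f2 x.
    rewrite imset_f //= -(@orb_congr f1 f2 (orb f1 x)) ?orb_refl //.
      move=> y yO; apply: eqf; rewrite inE (disjointFr disj yO).
      exact: subsetP (orb_sub f1A xA) _ yO.
    by move=> y; rewrite !inE => /connect_trans-> //; apply: fconnect1.
  apply: (@orb_congr _ _ (orb f1 x)); last exact: orb_refl.
    move=> y yO; apply: eqf; rewrite inE (disjointFr disj yO).
    exact: subsetP (orb_sub f1A xA) _ yO.
  by move=> y; rewrite !inE => /connect_trans-> //; apply: fconnect1.
move=> fA gA eqfg; apply/eqP; rewrite eqEsubset !sub //.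
by move=> x xA; rewrite eqfg.
Qed.

(** * Multiplication by a transposition *)

Definition twist f a b x := f (tperm a b x).

Lemma tperm_in (A : {set D}) a b x :
  a \in A -> b \in A -> x \in A -> tperm a b x \in A.
Proof. by move=> aA bA xA; case: tpermP => // ->. Qed.

Lemma permutes_twist f A a b : a \in A -> b \in A ->
  permutes f A -> permutes (twist f a b) A.
Proof.
move=> aA bA [injf fA]; split=> [x y xA yA /injf|x xA].
  by rewrite !tperm_in // => /(_ isT isT) /perm_inj.
by apply: fA; apply: tperm_in.
Qed.

(* Off the edge [{x, a x}] the map [s \o a] is, up to [a], the twisted rotation;
   on the edge the two maps agree. *)
Lemma frst_twist s a A x : permutes s A -> {in A, forall z, a z \in A} ->
  {in A, forall z, a (a z) = z} -> x \in A ->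
  {in A :\: [set x; a x], forall z, frst (fun z => s (a z)) (A :\: [set x; a x]) z
     = frst (twist s x (a x)) (A :\: [set x; a x]) (a z)}.
Proof.
move=> ps aA aK xA z; set Q := A :\: _; set g := twist _ _ _ => zQ.
have QA : Q \subset A by apply: subsetDl.
have axA := aA x xA; have zA := subsetP QA _ zQ.
have pf : permutes (fun z => s (a z)) A.
  split=> [t u tA uA|t tA]; last by apply/(proj2 ps)/aA.
  move/(proj1 ps); rewrite !aA // => /(_ isT isT) eqa.
  by rewrite -(aK t) // eqa aK.
have pg : permutes g A by apply: permutes_twist.
have azQ : a z \in Q.
  rewrite inE aA // andbT; case/setDP: zQ => _; apply: contra => /set2P[] eqz.
    by rewrite -(aK z zA) eqz set22.
  by rewrite -(aK z zA) eqz aK // set21.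
apply: (frst_eq pf QA zQ); have gaz : g (a z) = s (a z).
  rewrite /g /twist tpermD //.
    by apply: contraTneq azQ => <-; rewrite !inE eqxx.
  by apply: contraTneq azQ => <-; rewrite !inE eqxx orbT.
apply: (hits_congr (proj2 pg) _ _ gaz (frst_hits pg QA azQ)).
  move=> t; rewrite !inE => /andP[+ tA]; rewrite tA andbT negbK /g /twist.
  by case/orP=> /eqP->; rewrite ?tpermL ?tpermR ?aK.
by rewrite gaz; apply/(proj2 ps)/aA.
Qed.

(** A transposition splits the cycle of [a] if it contains [b], and otherwise joins two cycles; the
    equation states both without subtraction. It follows from the result on permutations of [D] once
    [f] is extended by the identity off [A], which adds the same fixed points to both counts. *)
Lemma ncyc_twist f A a b : permutes f A -> a \in A -> b \in A -> a != b ->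
  (ncyc (twist f a b) A + (b \notin orb f a).*2 = (ncyc f A).+1)%N.
Proof.
move=> pf aA bA neq_ab; have [injf fA] := pf.
pose F x := if x \in A then f x else x.
have injF : injective F.
  rewrite /F => x y; case: ifPn => xA; case: ifPn => yA //; first exact: injf.
    by move=> eqxy; rewrite -eqxy fA in yA.
  by move=> eqxy; rewrite eqxy fA in xA.
pose s := perm injF; pose s' := (tperm a b * s)%g.
have porb (t : {perm D}) g x : {in A, forall x, g x \in A} -> {in A, g =1 t} ->
    x \in A -> porbit t x = orb g x.
  move=> gA eqgt xA; rewrite (orb_congr eqgt gA xA); apply/setP=> y.
  rewrite inE; apply/porbitP/idP => [[i ->]|/iter_findex <-].
    by rewrite permX fconnect_iter.
  by exists (findex t x y); rewrite permX.
have nporb (t : {perm D}) g : permutes g A -> {in A, g =1 t} ->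
    {in ~: A, t =1 id} -> #|porbits t| = (ncyc g A + #|~: A|)%N.
  move=> [_ gA] eqgt tid; rewrite /porbits.
  have tA x : (x \in A) = (t x \in A).
    have [xA|xA] := boolP (x \in A); first by rewrite -eqgt // gA.
    by rewrite tid ?inE // (negbTE xA).
  have porb1 x : x \in ~: A -> porbit t x = [set x].
    move=> xA; apply/setP=> y; rewrite inE.
    apply/porbitP/eqP => [[i ->]|->]; last by exists 0%N; rewrite perm1.
    by elim: i => [|i]; rewrite ?perm1 // expgSr permM => ->; apply: tid.
  have -> : porbit t @: D = orb g @: A :|: set1 @: (~: A).
    apply/setP=> O; rewrite inE; apply/imsetP/orP => [[x _ ->]|].
      have [xA|xA] := boolP (x \in A); [left|right].
        by rewrite (porb t g) // imset_f.
      by rewrite porb1 ?inE // imset_f // inE.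
    case=> /imsetP[x xA ->]; exists x => //; last by rewrite porb1.
    by rewrite (porb t g).
  rewrite cardsU (card_imset (mem (~: A)) set1_inj) [_ :&: _](_ : _ = set0) ?cards0 ?subn0 //.
  apply/setP=> O; rewrite !inE; apply/negP=> /andP[/imsetP[x xA ->]].
  case/imsetP=> y yA /setP/(_ x); rewrite orb_refl inE => /esym/eqP def_x.
  by rewrite -def_x inE xA in yA.
have sA : {in A, f =1 s} by move=> x xA; rewrite permE /F xA.
have s'A : {in A, twist f a b =1 s'}.
  by move=> x xA; rewrite permM -sA ?tperm_in.
have := porbits_mul_tperm s a b; rewrite /= neq_ab.
rewrite (nporb s f) // => [|x]; last first.
  by rewrite inE => xA; rewrite permE /F (negbTE xA).
rewrite (nporb s' (twist f a b)) //; last first.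
- move=> x; rewrite inE => xA; rewrite permM tpermD ?permE /F ?(negbTE xA) //.
    by apply: contraNneq xA => <-.
  by apply: contraNneq xA => <-.
- exact: permutes_twist.
rewrite porbit_sym (porb s f) //; lia.
Qed.

End FirstReturn.

(** * Packaged graphs as labelled darts *)

Section Components.

Definition gcomps (T : finType) (r : rel T) (P : {set T}) : {set {set T}} :=
  [set [set B in P | connect r B0 B] | B0 in P].

Variables (T T' : finType) (P : {set T}) (r : rel T) (r' : rel T') (h : T -> T').
Hypotheses (r_in : forall B1 B2, r B1 B2 -> (B1 \in P) && (B2 \in P))
  (r_sym : symmetric r)
  (hr : forall B1 B2, r B1 B2 -> connect r' (h B1) (h B2))
  (h_fib : {in P &, forall B1 B2, h B1 = h B2 -> connect r B1 B2})
  (r'_lift : forall C1 C2, r' C1 C2 -> exists B1 B2,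
     [/\ B1 \in P, B2 \in P, h B1 = C1, h B2 = C2 & connect r B1 B2]).

(** A path in the image lifts edge by edge, and consecutive lifts are joined because each fibre of
    [h] is connected. Conversely, every edge maps to a connected pair. *)
Lemma connect_map : {in P &, forall B1 B2,
  connect r' (h B1) (h B2) = connect r B1 B2}.
Proof.
move=> B1 B2 PB1 PB2; apply/idP/idP.
  case/connectP=> p; elim: p B1 PB1 => [|C p IH] B1 PB1 /=.
    by move=> _ eqh; apply: h_fib.
  case/andP=> /r'_lift[A1 [A2 [PA1 PA2 hA1 <- cA]]] pth lst.
  apply: connect_trans (IH _ PA2 pth lst).
  by apply: connect_trans cA; apply: h_fib.
case/connectP=> p; elim: p B1 PB1 => [|C p IH] B1 PB1 /=.
  by move=> _ ->; apply: connect0.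
case/andP=> rBC pth lst; apply: connect_trans (hr rBC) _.
by apply: IH pth lst; case/andP: (r_in rBC).
Qed.

Lemma gcomps_sub K : K \in gcomps r P -> K \subset P.
Proof. by case/imsetP=> B _ ->; apply/subsetP=> C; rewrite inE => /andP[]. Qed.

Lemma gcomps_closed K B1 B2 : K \in gcomps r P -> B1 \in K -> B2 \in P ->
  connect r B1 B2 -> B2 \in K.
Proof.
case/imsetP=> B PB ->; rewrite !inE => /andP[_ c1] -> c2.
exact: connect_trans c1 c2.
Qed.

Lemma gcomps_class K B : K \in gcomps r P -> B \in K ->
  K = [set C in P | connect r B C].
Proof.
case/imsetP=> B0 PB0 ->; rewrite inE => /andP[PB c].
have c' : connect r B B0 by rewrite (sym_connect_sym r_sym).
apply/setP=> C; rewrite !inE; congr andb.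
by apply/idP/idP; apply: connect_trans.
Qed.

Lemma gcomps_fib K B : K \in gcomps r P -> B \in P ->
  (h B \in h @: K) = (B \in K).
Proof.
move=> cK PB; apply/imsetP/idP => [[C CK eqh]|BK]; last by exists B.
apply: (gcomps_closed cK CK) => //.
by apply: h_fib => //; apply: subsetP (gcomps_sub cK) _ CK.
Qed.

(** Taking images is a bijection between components: since fibres lie inside components, a component
    can be recovered from its image. *)
Lemma prod_gcomps_map (R : comNzRingType) (F : {set T'} -> R) :
  \prod_(K in gcomps r' (h @: P)) F K = \prod_(K in gcomps r P) F (h @: K).
Proof.
have -> : gcomps r' (h @: P) = [set h @: (K : {set T}) | K in gcomps r P].
  rewrite /gcomps -[RHS]imset_comp -[LHS]imset_comp; apply: eq_in_imset => B PB /=.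
  apply/setP=> C; rewrite inE; apply/andP/imsetP => [[/imsetP[A PA ->]]|[A]].
    by rewrite connect_map // => cA; exists A; rewrite // inE PA.
  rewrite inE => /andP[PA cA] ->; rewrite connect_map //; split=> //.
  exact: imset_f.
rewrite big_imset // => K1 K2 c1 c2 eqK; case/imsetP: (c1) => B PB def1.
have BK1 : B \in K1 by rewrite def1 inE PB connect0.
have BK2 : B \in K2 by rewrite -gcomps_fib // -eqK imset_f.
by rewrite (gcomps_class c1 BK1) (gcomps_class c2 BK2).
Qed.

End Components.

(** * The polynomial in terms of labelled darts *)

Section LabelModel.
Variables (D : finType) (gT : finGroupType) (Gam : {group gT}).
Implicit Types (S A : {set D}) (s a : D -> D).

Definition ladj (T : finType) S a (b : D -> T) (P : {set T}) : rel T :=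
  fun B1 B2 => [&& B1 \in P, B2 \in P &
    [exists x in S, (b x == B1) && (b (a x) == B2)]].

Definition fib (T : finType) S (b : D -> T) (K : {set T}) : {set D} :=
  [set x in S | b x \in K].

Definition ned a A : nat := #|[set [set x; a x] | x in A]|.

(* The number of boundary components: the isolated vertices, which are
   counted as all vertices minus the cycles of [s], have one each. *)
Definition lface s a A (m : nat) : int :=
  (ncyc (fun x => s (a x)) A)%:Z + m%:Z - (ncyc s A)%:Z.

(** One factor of [q1]: [b] sends a dart to its block, [n B] stands for the number of vertices in
    [B] and [w B] for its weight. No name of an isolated vertex enters. *)
Definition lterm (T : finType) S s a (b : D -> T) (n w : T -> nat)
    (K : {set T}) : algC :=
  let A := fib S b K in
  ordG Gam ^ ((ned a A)%:Z - #|K|%:Z) *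
  sumdeg Gam (lface s a A (\sum_(B in K) n B) - (ned a A)%:Z + #|K|%:Z
              - (\sum_(B in K) w B)%N%:Z).

Definition lq (T : finType) S s a (b : D -> T) (P : {set T}) (n w : T -> nat)
    : algC :=
  \prod_(K in gcomps (ladj S a b P) P) lterm S s a b n w K.

Definition lwf (T : finType) S s a (b : D -> T) (P : {set T}) : Prop :=
  [/\ permutes s S, {in S, forall x, a x \in S},
      {in S, forall x, a (a x) = x /\ a x != x},
      {in S, forall x, b (s x) = b x} & {in S, forall x, b x \in P}].

Lemma ordG_neq0 : ordG Gam != 0.
Proof. by rewrite /ordG pnatr_eq0 -lt0n cardG_gt0. Qed.

Lemma ladj_in T S a b (P : {set T}) B1 B2 :
  ladj S a b P B1 B2 -> (B1 \in P) && (B2 \in P).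
Proof. by case/and3P=> -> ->. Qed.

Lemma ladj_sym T S s a b (P : {set T}) :
  lwf S s a b P -> symmetric (ladj S a b P).
Proof.
case=> _ aS aK _ _.
suff sub B1 B2 : ladj S a b P B1 B2 -> ladj S a b P B2 B1.
  by move=> B1 B2; apply/idP/idP; apply: sub.
case/and3P=> PB1 PB2 /existsP[x /and3P[xS b1 b2]].
rewrite /ladj PB1 PB2 /=; apply/existsP; exists (a x).
by rewrite aS // (proj1 (aK x xS)) b1 b2.
Qed.

Lemma ladjI T S s a b (P : {set T}) x : lwf S s a b P -> x \in S ->
  ladj S a b P (b x) (b (a x)).
Proof.
case=> _ aS _ _ bP xS; rewrite /ladj !bP ?aS //=.
by apply/existsP; exists x; rewrite xS !eqxx.
Qed.

Lemma permutes_alpha T S s a b (P : {set T}) : lwf S s a b P ->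
  permutes (fun x => s (a x)) S.
Proof.
case=> [[injs sS] aS aK _ _]; split=> [x y xS yS|x xS]; last by apply/sS/aS.
move/injs; rewrite !aS // => /(_ isT isT) eqa.
by rewrite -(proj1 (aK x xS)) eqa (proj1 (aK y yS)).
Qed.

Lemma lq_congr (T : finType) S s s' a a' (b b' : D -> T) P n n' w w' :
  lwf S s a b P -> {in S, s =1 s'} -> {in S, a =1 a'} -> {in S, b =1 b'} ->
  {in P, n =1 n'} -> {in P, w =1 w'} ->
  lq S s a b P n w = lq S s' a' b' P n' w'.
Proof.
move=> wf eqs eqa eqb eqn eqw; have [ps aS aK bs bP] := wf.
have eqadj : ladj S a b P =2 ladj S a' b' P.
  move=> B1 B2; rewrite /ladj; congr [&& _, _ & _]; apply: eq_existsb => x.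
  by have [xS|//] := boolP (x \in S); rewrite -eqa // -!eqb ?aS.
rewrite /lq; have -> : gcomps (ladj S a' b' P) P = gcomps (ladj S a b P) P.
  apply: eq_imset => B; apply/setP=> C; rewrite !inE.
  by rewrite (eq_connect eqadj).
apply: eq_bigr => K /gcomps_sub/subsetP KP; rewrite /lterm.
have -> : fib S b' K = fib S b K.
  by apply/setP=> x; rewrite !inE; case xS: (x \in S); rewrite // eqb.
have subS : fib S b K \subset S by apply/subsetP=> x; rewrite inE => /andP[].
rewrite (eq_bigr n' (fun B KB => eqn B (KP B KB))).
rewrite (eq_bigr w' (fun B KB => eqw B (KP B KB))).
have -> : ned a (fib S b K) = ned a' (fib S b K).
  rewrite /ned; congr #|(_ : {set {set D}})|; apply: eq_in_imset => x.
  by move/(subsetP subS)=> xS; rewrite eqa.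
rewrite /lface (ncyc_congr eqs (proj2 ps) subS).
congr (_ * sumdeg _ (_%:Z + _ - _ - _ + _ - _)).
apply: (ncyc_congr _ (proj2 (permutes_alpha wf)) subS) => x xS.
by rewrite -eqa // eqs // aS.
Qed.

(** This serves to replace blocks by their images under [vtrans] after a deletion. *)
Lemma lq_relabel (T T' : finType) S s a (b : D -> T) P n w
    (h : T -> T') n' w' :
  lwf S s a b P -> {in P &, injective h} ->
  {in P, forall B, n' (h B) = n B} -> {in P, forall B, w' (h B) = w B} ->
  lq S s a (fun x => h (b x)) (h @: P) n' w' = lq S s a b P n w.
Proof.
move=> wf injh eqn eqw; have [ps aS aK bs bP] := wf.
rewrite /lq (@prod_gcomps_map _ _ _ (ladj S a b P) _ h).
- apply: eq_bigr => K cK; have /subsetP KP := gcomps_sub cK; rewrite /lterm.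
  have injK : {in K &, injective h} by move=> B C /KP PB /KP; apply: injh.
  have -> : fib S (fun x => h (b x)) (h @: K) = fib S b K.
    apply/setP=> x; rewrite !inE; case xS: (x \in S) => //=.
    apply/imsetP/idP => [[B KB eqh]|]; last by exists (b x).
    by rewrite (injh _ _ _ _ eqh) ?bP ?KP.
  rewrite card_in_imset // !big_imset //=.
  rewrite (eq_bigr n (fun B KB => eqn B (KP B KB))).
  by rewrite (eq_bigr w (fun B KB => eqw B (KP B KB))).
- exact: ladj_in.
- exact: ladj_sym wf.
- move=> B1 B2 /and3P[PB1 PB2 /existsP[x /and3P[xS /eqP b1 /eqP b2]]].
  apply: connect1; rewrite /ladj !imset_f //=; apply/existsP; exists x.
  by rewrite xS b1 b2 !eqxx.
- by move=> B1 B2 PB1 PB2 /injh-> //; apply: connect0.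
- move=> C1 C2 /and3P[_ _ /existsP[x /and3P[xS /eqP b1 /eqP b2]]].
  exists (b x), (b (a x)); split; rewrite ?bP ?aS //.
  exact/connect1/(ladjI wf).
Qed.

End LabelModel.

(** * Contraction of an edge *)

Section Contraction.
Variables (D T T' : finType) (gT : finGroupType) (Gam : {group gT}).
Variables (S : {set D}) (s a : D -> D) (b : D -> T) (P : {set T}).
Variables (n w : T -> nat) (h : T -> T') (n' w' : T' -> nat) (x : D).
Hypotheses (wf : lwf S s a b P) (xS : x \in S).
Let y := a x.
Let e : {set D} := [set x; y].
Let M : {set T} := [set b x; b y].
Let s1 := frst (twist s x y) (S :\: e).
Let h1 z := h (b z).
(** The update rules (i) to (iii) in a single form. Contracting a loop adds a vertex and contracting
    a non-loop removes one, whence [n'_merge]. In [w'_merge] the term [#|M|] separates the cases: a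
    single block gains weight 1, two distinct blocks add their weights. *)
Hypotheses (h_merge : h (b x) = h (b y))
  (h_inj : {in P &, forall B1 B2, h B1 = h B2 ->
     B1 = B2 \/ (B1 \in M) && (B2 \in M)})
  (n'_other : {in P, forall B, B \notin M -> n' (h B) = n B})
  (w'_other : {in P, forall B, B \notin M -> w' (h B) = w B})
  (n'_merge : (n' (h (b x)) + (y \notin orb s x).*2
               = (\sum_(B in M) n B).+1)%N)
  (w'_merge : (w' (h (b x)) + #|M| = (\sum_(B in M) w B).+2)%N).

Let yS : y \in S. Proof. by case: wf => _ aS _ _ _; apply: aS. Qed.
Let ay : a y = x. Proof. by case: wf => _ _ aK _ _; case: (aK x xS). Qed.
Let neq_yx : y != x. Proof. by case: wf => _ _ aK _ _; case: (aK x xS). Qed.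
Let eS : e \subset S.
Proof. by apply/subsetP=> z; rewrite !inE => /orP[] /eqP->. Qed.
Let MP : M \subset P.
Proof.
by case: wf => _ _ _ _ bP; apply/subsetP=> B /set2P[->|->]; apply: bP.
Qed.

Let cPM : {in M &, forall B1 B2, connect (ladj S a b P) B1 B2}.
Proof.
have c1 : ladj S a b P (b x) (b y) by exact: (ladjI wf xS).
move=> B1 B2 /set2P[] -> /set2P[] ->; rewrite ?connect0 ?connect1 //.
by rewrite (ladj_sym wf).
Qed.

Let h_fib : {in P &, forall B1 B2, h B1 = h B2 ->
  connect (ladj S a b P) B1 B2}.
Proof.
move=> B1 B2 PB1 PB2 /h_inj-/(_ PB1 PB2)[->|/andP[M1 M2]]; first exact: connect0.
exact: cPM.
Qed.

Let hM B : B \in M -> h B = h (b x).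
Proof. by case/set2P=> ->. Qed.

Let xCe z : z \in S -> z \notin e -> a z \in S :\: e.
Proof.
case: wf => _ aS aK _ _ zS; rewrite !inE !negb_or aS // => /andP[zx zy].
rewrite andbT; apply/andP; split; apply: contraNneq zx => eqz.
  by rewrite -(proj1 (aK z zS)) eqz eqxx in zy.
by rewrite -(proj1 (aK z zS)) eqz ay.
Qed.

Section Component.
Variable K : {set T}.
Hypothesis cK : K \in gcomps (ladj S a b P) P.
Let A := fib S b K.

Let AS : A \subset S. Proof. by apply/subsetP=> z; rewrite inE => /andP[]. Qed.
Let KP : K \subset P. Proof. exact: gcomps_sub cK. Qed.

Let As : {in A, forall z, s z \in A}.
Proof.
case: wf => -[_ sS] _ _ bs _ z; rewrite !inE => /andP[zS bK].
by rewrite sS // bs.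
Qed.

Let Aa : {in A, forall z, a z \in A}.
Proof.
case: (wf) => _ aS aK bs bP z; rewrite !inE => /andP[zS bK].
rewrite aS //=; apply: (gcomps_closed cK bK); first exact/bP/aS.
exact/connect1/(ladjI wf).
Qed.

Let psA : permutes s A.
Proof.
split=> // z t zA tA; case: wf => -[injs _] _ _ _ _.
by apply: injs; apply: (subsetP AS).
Qed.

Let fibE : fib (S :\: e) h1 (h @: K) = A :\: e.
Proof.
apply/setP=> z; rewrite !inE /h1; have [zS|] := boolP (z \in S); last first.
  by rewrite !andbF.
rewrite andbT; congr andb; apply: (gcomps_fib h_fib cK).
by case: wf => _ _ _ _; apply.
Qed.

(** Such a component has no dart of [e], so the twisted rotation returns to [S :\: e] after one
    ordinary step of [s], and [h] is injective on its blocks. *)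
Lemma lterm_contract_off : b x \notin K ->
  lterm Gam S s a b n w K = lterm Gam (S :\: e) s1 a h1 n' w' (h @: K).
Proof.
move=> bxK; have [ps aS aK bs bP] := wf.
have byK : b y \notin K.
  by apply: contra bxK => byK; apply: (gcomps_closed cK byK);
    [apply: bP | apply: cPM; rewrite !inE eqxx ?orbT].
have notM B : B \in K -> B \notin M.
  by move=> BK; apply/negP=> /set2P[] def; rewrite def (negbTE bxK, negbTE byK) in BK.
have injK : {in K &, injective h}.
  move=> B C BK CK /h_inj []; rewrite ?(subsetP KP) //.
  by rewrite (negbTE (notM _ BK)).
have Ae : [disjoint A & e].
  apply/pred0P=> z /=; apply/negP=> /andP[]; rewrite !inE => /andP[_ bK].
  by case/orP=> /eqP def; rewrite def (negbTE bxK, negbTE byK) in bK.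
have defA : A :\: e = A by apply/setDidPl.
have s1A : {in A, s =1 s1}.
  move=> z zA; have zSe : z \in S :\: e.
    by rewrite inE (subsetP AS _ zA) (disjointFr Ae zA).
  have gz : twist s x y z = s z.
    rewrite /twist tpermD //; apply: contraTneq zA => <-;
      by rewrite (disjointFl Ae) // !inE eqxx ?orbT.
  apply/esym/(frst_eq (permutes_twist xS yS ps)) => //; first exact: subsetDl.
  rewrite -gz; apply: hits_here; rewrite gz inE.
  by rewrite (subsetP AS _ (As zA)) (disjointFr Ae (As zA)).
rewrite /lterm fibE -/A defA card_in_imset // !big_imset //=.
rewrite (eq_bigr n (fun B KB => n'_other (subsetP KP _ KB) (notM _ KB))).
rewrite (eq_bigr w (fun B KB => w'_other (subsetP KP _ KB) (notM _ KB))).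
rewrite /lface (ncyc_congr s1A As) //.
rewrite (@ncyc_congr _ (fun z => s (a z)) (fun z => s1 (a z)) A) //.
  by move=> z zA; apply/s1A/Aa.
by move=> z zA; apply/As/Aa.
Qed.

(** The component loses one edge and [#|M| - 1] blocks, and its total weight changes by [2 - #|M|].
    The number of boundary components is unchanged, so the exponents in [sumdeg] agree and only a
    power of the group order remains. *)
Lemma lterm_contract_on : b x \in K ->
  lterm Gam S s a b n w K = ordG Gam ^ (2%:Z - #|M|%:Z) *
    lterm Gam (S :\: e) s1 a h1 n' w' (h @: K).
Proof.
move=> bxK; have [ps aS aK bs bP] := wf.
have byK : b y \in K.
  by apply: (gcomps_closed cK bxK);
    [apply: bP | apply: cPM; rewrite !inE eqxx ?orbT].
have MK : M \subset K by apply/subsetP=> B /set2P[] ->.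
have xA : x \in A by rewrite inE xS.
have yA : y \in A by rewrite inE yS.
have eA : e \subset A by apply/subsetP=> z /set2P[] ->.
pose K1 := K :\: M.
have K1P B : B \in K1 -> B \in P by case/setDP=> /(subsetP KP).
have injK : {in K1 &, injective h}.
  move=> B C BK CK /h_inj []; rewrite ?K1P //.
  by case/setDP: BK => _ /negbTE->.
have hbx : h (b x) \notin h @: K1.
  apply/negP=> /imsetP[B BK /h_inj[]]; rewrite ?bP ?K1P //.
    by move=> def; case/setDP: BK; rewrite -def !inE eqxx.
  by case/setDP: BK => _ /negbTE->; rewrite andbF.
have hK : h @: K = h (b x) |: h @: K1.
  rewrite -(setID K M) (setIidPr MK) imsetU -/K1; congr (_ :|: _).
  apply/setP=> C; rewrite inE; apply/imsetP/eqP => [[B /hM-> //]|->].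
  by exists (b x) => //; rewrite !inE eqxx.
(* The same bookkeeping serves the vertex counts and the weights: only the terms of the merged block
   differ. *)
have sumK (n0 : T -> nat) (n0' : T' -> nat) :
    {in P, forall B, B \notin M -> n0' (h B) = n0 B} ->
    (\sum_(C in h @: K) n0' C + \sum_(B in M) n0 B =
     n0' (h (b x)) + \sum_(B in K) n0 B)%N.
  move=> eqn; rewrite hK big_setU1 // big_imset //= -addnA; congr addn.
  rewrite [RHS](big_setID M) /= (setIidPr MK) addnC; congr addn.
  apply: eq_bigr => B BK; apply: eqn; first exact: K1P.
  by case/setDP: BK.
have cardK : (#|h @: K| + #|M| = #|K|.+1)%N.
  rewrite hK cardsU1 hbx card_in_imset // add1n addSn; congr succn.
  by rewrite -(cardsID M K) (setIidPr MK) addnC.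
have nedA : ned a A = (ned a (A :\: e)).+1.
  rewrite /ned; have -> : [set [set z; a z] | z in A] =
      e |: [set [set z; a z] | z in A :\: e].
    apply/setP=> O; rewrite inE in_set1; apply/imsetP/orP => [[z zA ->]|].
      have [ze|ze] := boolP (z \in e); last first.
        by right; apply: imset_f; rewrite inE ze.
      left; case/set2P: ze => ->; rewrite ?ay //.
      by apply/eqP; rewrite setUC.
    case=> [/eqP->|/imsetP[z /setDP[zA _] ->]]; last by exists z.
    by exists x.
  rewrite cardsU1 [_ \notin _](_ : _ = true) //; apply/negP=> /imsetP[z].
  by case/setDP=> zA ze /setP/(_ z); rewrite set21 => ze'; rewrite ze' in ze.
set g := twist s x y; pose f z := s (a z); pose Q := A :\: e.
have QA : Q \subset A by apply: subsetDl.
have pf : permutes f A.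
  split=> [z t zA tA|z zA]; last exact/As/Aa.
  by apply: (proj1 (permutes_alpha wf)); apply: (subsetP AS).
have pg : permutes g A by apply: permutes_twist.
(* On the two darts of [e] the involution [a] is the transposition of [x] and [y], so both maps lose
   the same dead orbits. *)
have eqfg : {in A :\: Q, f =1 g}.
  move=> z; rewrite /f /g /twist /Q !inE => /andP[+ zA].
  rewrite zA andbT negbK.
  by case/orP=> /eqP->; rewrite ?tpermL ?tpermR ?ay.
have dead : dead_orbits f A Q = dead_orbits g A Q.
  by apply: dead_orbits_congr; [case: pf | case: pg |].
have s1Q : {in Q, s1 =1 frst g Q}.
  move=> z zQ; have defQ : Q = A :&: (S :\: e).
    by rewrite setIDA (setIidPl AS).
  rewrite /s1 defQ (@frst_restrict _ _ S A) -?defQ ?subsetDl //.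
    exact: permutes_twist.
  by case: pg.
have aQ z : z \in Q -> a z \in Q.
  case/setDP=> zA ze; rewrite inE Aa // andbT.
  by case/setDP: (xCe (subsetP AS _ zA) ze).
have s1aQ : {in Q, (fun z => s1 (a z)) =1 frst f Q}.
  move=> z zQ; rewrite s1Q ?aQ //; apply/esym/(frst_twist psA Aa) => //.
  by move=> t tA; case: (aK t (subsetP AS _ tA)).
have s1QQ : {in Q, forall z, s1 z \in Q}.
  by move=> z zQ; rewrite s1Q // (frst_mem pg).
have cf : ncyc f A = (ncyc (fun z => s1 (a z)) Q + #|dead_orbits f A Q|)%N.
  by rewrite (ncyc_frst pf QA) (ncyc_congr s1aQ) // => z zQ; apply/s1QQ/aQ.
have cg : ncyc g A = (ncyc s1 Q + #|dead_orbits f A Q|)%N.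
  by rewrite (ncyc_congr s1Q) // dead (ncyc_frst pg QA).
have ct : (ncyc g A + (y \notin orb s x).*2 = (ncyc s A).+1)%N.
  by apply: ncyc_twist => //; rewrite eq_sym.
have sn := sumK n n' n'_other; have sw := sumK w w' w'_other.
rewrite /lterm /= fibE -/A -/Q mulrA -expfzDr ?ordG_neq0 // nedA.
congr (_ * _); first by congr (_ ^ _); rewrite -/Q; move: cardK; clear; lia.
congr (sumdeg _ _).
(* The dead orbits cancel in [lface], and the effect of the transposition on the cycles is balanced
   by [n'_merge]. What is left is linear arithmetic in the counts. *)
rewrite /lface -/f -/Q cf; move: ct; rewrite cg => {cf cg} ct.
move: n'_merge w'_merge sn sw cardK ct; rewrite -/e -/M.
clear.
move: (ncyc _ _) (ncyc _ _) (ncyc _ _) #|dead_orbits _ _ _| (ned _ _) #|M| #|K|.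
move: #|_| (nat_of_bool _) (n' _) (w' _).
move: (\sum_(_ in M) _)%N (\sum_(_ in M) _)%N.
move: (\sum_(_ in K) _)%N (\sum_(_ in K) _)%N.
move: (\sum_(_ in _) _)%N (\sum_(_ in _) _)%N.
lia.
Qed.

End Component.

(** Exactly one component contains the blocks of [e]; it supplies the power of the group order, and
    every other factor is unchanged. *)
Lemma lq_contract : lq Gam S s a b P n w =
  ordG Gam ^ (2%:Z - #|M|%:Z) * lq Gam (S :\: e) s1 a h1 (h @: P) n' w'.
Proof.
have [ps aS aK bs bP] := wf.
rewrite /lq (@prod_gcomps_map _ _ _ (ladj S a b P) _ h).
- pose K0 := [set B in P | connect (ladj S a b P) (b x) B].
  have cK0 : K0 \in gcomps (ladj S a b P) P by apply: imset_f; apply: bP.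
  have bxK0 : b x \in K0 by rewrite inE bP ?connect0.
  rewrite (bigD1 K0) //= [in RHS](bigD1 K0) //= mulrA.
  rewrite lterm_contract_on //; congr (_ * _).
  apply: eq_bigr => K /andP[cK neqK]; apply: lterm_contract_off => //.
  by apply: contra neqK => bxK; rewrite (gcomps_class (ladj_sym wf) cK bxK).
- exact: ladj_in.
- exact: ladj_sym wf.
- move=> B1 B2 /and3P[PB1 PB2 /existsP[z /and3P[zS /eqP b1 /eqP b2]]].
  (* An adjacency that comes from [e] itself becomes an equality after merging; any other dart still
     witnesses it. *)
  have [ze|ze] := boolP (z \in e).
    rewrite -b1 -b2; suff -> : h (b z) = h (b (a z)) by apply: connect0.
    by case/set2P: ze => ->; rewrite ?ay.
  apply: connect1; rewrite /ladj !imset_f //=; apply/existsP; exists z.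
  by rewrite inE zS ze /= /h1 b1 b2 !eqxx.
- exact: h_fib.
- move=> C1 C2 /and3P[_ _ /existsP[z /and3P[/setDP[zS _] /eqP b1 /eqP b2]]].
  exists (b z), (b (a z)); split; rewrite ?bP ?aS //.
  exact/connect1/(ladjI wf).
Qed.

End Contraction.

(** * Ribbon graphs *)

Section PartitionImage.
Variables (T T' : finType) (t : T -> T') (E : {set T}) (P : {set {set T}}).
Hypotheses (injt : {in E &, injective t}) (partP : partition P E).

Lemma imset_in_inj : {in P &, injective (fun B : {set T} => t @: B)}.
Proof.
have sub B C : B \in P -> C \in P -> t @: B = t @: C -> B \subset C.
  move=> PB PC eqBC; apply/subsetP=> v vB.
  have /imsetP[u uC] : t v \in t @: C by rewrite -eqBC imset_f.
  move/injt=> -> //; first exact: subsetP (partitionS partP PB) _ vB.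
  exact: subsetP (partitionS partP PC) _ uC.
by move=> B C PB PC eqBC; apply/eqP; rewrite eqEsubset !sub.
Qed.

Lemma partition_imset_in :
  partition [set t @: B | B : {set T} in P] (t @: E).
Proof.
apply/and3P; split.
- rewrite cover_imset -(cover_partition partP) /cover; apply/eqP.
  apply/setP=> u; apply/bigcupP/imsetP.
    case=> B PB /imsetP[v vB ->]; exists v => //; apply/bigcupP.
    by exists B.
  by case=> v /bigcupP[B PB vB] ->; exists B => //; apply: imset_f.
- apply/trivIsetP=> _ _ /imsetP[B PB ->] /imsetP[C PC ->] neq.
  apply/pred0P=> u /=; apply/negP=> /andP[/imsetP[v vB ->] /imsetP[v' vC]].
  have vE := subsetP (partitionS partP PB) _ vB.
  move/(injt vE (subsetP (partitionS partP PC) _ vC)) => eqv.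
  case/negP: neq; rewrite -(def_pblock (partition_trivIset partP) PB vB) eqv.
  by rewrite (def_pblock (partition_trivIset partP) PC vC).
apply/imsetP=> -[B PB /esym/eqP]; rewrite imset_eq0.
by apply/negP; apply: partition_neq0 partP PB.
Qed.

Lemma pblock_imset_in v : v \in E ->
  pblock [set t @: B | B : {set T} in P] (t v) = t @: pblock P v.
Proof.
move=> vE; have vP : v \in cover P by rewrite (cover_partition partP).
apply: def_pblock; last by rewrite imset_f // mem_pblock.
  exact: partition_trivIset partition_imset_in.
by apply: imset_f; apply: pblock_mem.
Qed.

Lemma preimset_in (B : {set T}) : B \in P -> [set v in E | t v \in t @: B] = B.
Proof.
move=> PB; have BE := subsetP (partitionS partP PB).
apply/setP=> v; rewrite inE; apply/andP/idP => [[vE /imsetP[u uB]]|vB].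
  by move/injt=> -> //; apply: BE.
by rewrite BE // imset_f.
Qed.

End PartitionImage.

(** * Well-formed ribbon graphs and their labelled darts *)

Section Graphs.
Variable D : finType.
Implicit Types (G : rgraph D) (X : {set D}) (P K : {set {set vtx D}}).

Lemma wf_permutes G : wf_rg G -> permutes (rsg G) (rS G).
Proof. by case=> -[]. Qed.

Lemma wf_ral G : wf_rg G -> {in rS G, forall x, ral G x \in rS G}.
Proof. by case=> -[]. Qed.

Lemma wf_ralK G : wf_rg G ->
  {in rS G, forall x, ral G (ral G x) = x /\ ral G x != x}.
Proof. by case=> -[]. Qed.

Lemma wf_dual G : wf_rg G -> wf_rg (dual G).
Proof.
case=> -[injs aS aK NI tI] sS; split; last by move=> x xS; apply/sS/aS.
split=> // x y xS yS /injs; rewrite !aS // => /(_ isT isT) eqa.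
by rewrite -(proj1 (aK x xS)) eqa (proj1 (aK y yS)).
Qed.

Definition alpha_closed G X : Prop :=
  X \subset rS G /\ {in X, forall x, ral G x \in X}.

Lemma alpha_closedD G X x : wf_rg G -> alpha_closed G X ->
  x \in rS G :\: X -> ral G x \in rS G :\: X.
Proof.
move=> wf [XS aX] /setDP[xS xX]; rewrite inE (wf_ral wf) // andbT.
by apply: contra xX => /aX; rewrite (proj1 (wf_ralK wf xS)).
Qed.

Lemma vorbitE G : vorbit G =1 orb (rsg G).
Proof. by []. Qed.

Lemma vorbit_sub G x : wf_rg G -> x \in rS G -> vorbit G x \subset rS G.
Proof. by case/wf_permutes=> _ sS; apply: orb_sub. Qed.

Lemma eq_vorbit G x y : wf_rg G -> x \in rS G -> y \in vorbit G x ->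
  vorbit G x = vorbit G y.
Proof.
move=> wf xS yx; have yS := subsetP (vorbit_sub wf xS) _ yx.
by apply/eqP; rewrite (eq_orb (wf_permutes wf)).
Qed.

Lemma isolated_neq_vorbit G N x : wf_rg G -> N \in rI G -> x \in rS G ->
  N != vorbit G x.
Proof.
move=> [[_ _ _ NI _] _] /NI[_ /disjointFr dN] xS; apply: contraTneq xS => def.
by rewrite dN // def orb_refl.
Qed.

(** A new isolated vertex is named by a cycle contained in [X], hence disjoint from the remaining
    darts. It is also disjoint from other cycles and from the old names, which contain no dart of
    [G]. *)
Lemma wf_del G X : wf_rg G -> alpha_closed G X -> wf_rg (del G X).
Proof.
move=> wf cX; have [injQ QQ] := permutes_frst (wf_permutes wf) (subsetDl (rS G) X).
have [[injs aS aK NI tI] sS] := wf; split; last exact: QQ.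
split=> //=.
- by move=> x; apply: alpha_closedD.
- by move=> x /setDP[/aK].
- move=> N; rewrite inE => /orP[/NI[N0 dN]|].
    split=> //; apply: disjointWr dN; exact: subsetDl.
  case/imsetP=> x; rewrite inE => /andP[xS sub] ->; split.
    by apply/set0Pn; exists x; apply: orb_refl.
  apply/pred0P=> z /=; apply/negP=> /andP[/(subsetP sub) zX].
  by rewrite inE zX.
apply/trivIsetP=> A B; rewrite !inE.
have dNO N x : N \in rI G -> x \in rS G -> [disjoint N & vorbit G x].
  by move=> /NI[_ dN] xS; apply: disjointWr dN; apply: vorbit_sub.
case/orP=> [IA|/imsetP[x + ->]] /orP[IB|/imsetP[y + ->]]; rewrite ?inE.
- exact: (trivIsetP tI).
- by case/andP=> xS _ _; apply: dNO.
- by case/andP=> xS _ _; rewrite disjoint_sym; apply: dNO.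
case/andP=> xS _ /andP[yS _] neq; apply/pred0P=> z /=.
apply/negP=> /andP[zx zy]; case/negP: neq.
by rewrite (eq_vorbit wf xS zx) (eq_vorbit wf yS zy).
Qed.

(** Equality of ribbon graphs up to the values of the two maps off the darts present. The double
    dual gives back a graph only in this sense. *)
Definition eqrg G1 G2 : Prop :=
  [/\ rS G1 = rS G2, {in rS G1, rsg G1 =1 rsg G2},
      {in rS G1, ral G1 =1 ral G2} & rI G1 = rI G2].

Lemma eqrg_vorbit G1 G2 x : wf_rg G1 -> eqrg G1 G2 -> x \in rS G1 ->
  vorbit G1 x = vorbit G2 x.
Proof.
move=> wf [_ eqs _ _]; apply: orb_congr eqs _.
by case: (wf_permutes wf).
Qed.

Lemma eqrg_verts G1 G2 : wf_rg G1 -> eqrg G1 G2 -> verts G1 = verts G2.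
Proof.
move=> wf eqG; have [eS _ _ eI] := eqG; rewrite /verts eI -eS; congr (_ :|: _).
by apply: eq_in_imset => x xS; rewrite (eqrg_vorbit wf eqG).
Qed.

Lemma eqrg_dual G1 G2 : wf_rg G1 -> eqrg G1 G2 -> eqrg (dual G1) (dual G2).
Proof.
move=> wf [eS eqs eqa eI]; split=> //= x xS.
by rewrite -eqa // eqs // (wf_ral wf).
Qed.

Lemma eqrg_del G1 G2 X : wf_rg G1 -> eqrg G1 G2 -> eqrg (del G1 X) (del G2 X).
Proof.
move=> wf eqG; have [eS eqs eqa eI] := eqG; split=> /=; first by rewrite eS.
- rewrite -eS; apply: frst_congr (wf_permutes wf) _ eqs; exact: subsetDl.
- by move=> x /setDP[xS _]; apply: eqa.
rewrite eI; congr (_ :|: _); apply/setP=> O.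
apply/imsetP/imsetP=> -[x]; rewrite inE => /andP[xS sub] ->.
  exists x; last exact: eqrg_vorbit.
  by rewrite inE -(eqrg_vorbit wf eqG xS) -eS xS.
rewrite -eS in xS; exists x; last by rewrite (eqrg_vorbit wf eqG).
by rewrite inE (eqrg_vorbit wf eqG xS) xS.
Qed.

Lemma eqrg_dualK G : wf_rg G -> eqrg (dual (dual G)) G.
Proof. by move=> wf; split=> //= x xS; rewrite (proj1 (wf_ralK wf xS)). Qed.

Definition blk G P x : {set vtx D} := pblock P (inl (vorbit G x)).

Lemma inl_verts G x : x \in rS G -> inl (vorbit G x) \in verts G.
Proof. by move=> xS; rewrite inE; apply/orP; left; apply: imset_f. Qed.

Lemma inr_verts G N : (inr N \in verts G) = (N \in rI G).
Proof.
rewrite inE; apply/orP/idP => [[/imsetP[]//|/imsetP[M IM [->]]//]|IN].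
by right; apply: imset_f.
Qed.

Lemma inl_vertsP G O : inl O \in verts G ->
  exists2 x, x \in rS G & O = vorbit G x.
Proof.
by rewrite inE => /orP[/imsetP[x xS [->]]|/imsetP[]//]; exists x.
Qed.

Lemma mem_blk G P x : partition P (verts G) -> x \in rS G ->
  inl (vorbit G x) \in blk G P x.
Proof.
by move=> pP xS; rewrite mem_pblock (cover_partition pP) inl_verts.
Qed.

Lemma blk_mem G P x : partition P (verts G) -> x \in rS G -> blk G P x \in P.
Proof.
by move=> pP xS; rewrite pblock_mem // (cover_partition pP) inl_verts.
Qed.

Lemma blkE G P x B : partition P (verts G) -> B \in P -> x \in rS G ->
  (inl (vorbit G x) \in B) = (blk G P x == B).
Proof.
move=> pP PB xS; apply/idP/eqP => [|<-]; last exact: mem_blk.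
exact: def_pblock (partition_trivIset pP) PB.
Qed.

Lemma lwf_graph G P : wf_rg G -> partition P (verts G) ->
  lwf (rS G) (rsg G) (ral G) (blk G P) P.
Proof.
move=> wf pP; split.
- exact: wf_permutes.
- exact: wf_ral.
- exact: wf_ralK.
- move=> x xS; rewrite /blk (@eq_vorbit G x (rsg G x)) //.
  by rewrite inE fconnect1.
by move=> x; apply: blk_mem.
Qed.

Lemma lwf_frst (T : finType) (S Q : {set D}) s a (b : D -> T) (P : {set T}) :
  lwf S s a b P -> Q \subset S -> {in Q, forall x, a x \in Q} ->
  lwf Q (frst s Q) a b P.
Proof.
move=> [ps aS aK bs bP] QS aQ; have sub := subsetP QS.
split=> //; first exact: permutes_frst ps QS.
- by move=> x /sub/aK.
- move=> x xQ; have h := frst_hits ps QS xQ.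
  elim: h (sub _ xQ) => {x xQ} [x _|x y _ _ IH] xS; first exact: bs.
  by rewrite IH ?bs //; case: ps => _; apply.
by move=> x /sub/bP.
Qed.

Variables (gT : finGroupType) (Gam : {group gT}).

Lemma card_verts G : #|verts G| = (ncyc (rsg G) (rS G) + #|rI G|)%N.
Proof.
rewrite /verts cardsU (_ : _ :&: _ = set0) ?cards0 ?subn0; last first.
  apply/setP=> v; rewrite in_set0 inE; apply/negP=> /andP[/imsetP[? _ ->]].
  by case/imsetP.
have inl_inj : injective (@inl {set D} {set D}) by move=> ? ? [].
have inr_inj : injective (@inr {set D} {set D}) by move=> ? ? [].
by rewrite (imset_comp inl (vorbit G)) (card_imset _ inl_inj) (card_imset _ inr_inj).
Qed.

(** Blocks are disjoint, so their sizes add up to that of their union, whose elements are either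
    cycles of the rotation or isolated names. *)
Lemma verts_cover G P K : wf_rg G -> partition P (verts G) -> K \subset P ->
  (\sum_(B in K) #|B|)%N = (ncyc (rsg G) (fib (rS G) (blk G P) K)
     + #|[set N in rI G | inr N \in cover K]|)%N.
Proof.
move=> wf pP KP; have trivK := trivIsetS KP (partition_trivIset pP).
have /eqnP -> := trivK.
have inl_inj : injective (@inl {set D} {set D}) by move=> ? ? [].
have inr_inj : injective (@inr {set D} {set D}) by move=> ? ? [].
rewrite /ncyc -(card_imset _ inl_inj) -(card_imset [set N in rI G | _] inr_inj).
rewrite -cardsUI (_ : _ :&: _ = set0); last first.
  apply/setP=> v; rewrite in_set0 inE; apply/negP=> /andP[/imsetP[? _ ->]].
  by case/imsetP.
rewrite cards0 addn0; congr #|(_ : {set _})|.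
have coverS : cover K \subset verts G.
  apply/subsetP=> v /bigcupP[B /(subsetP KP) PB vB].
  exact: subsetP (partitionS pP PB) _ vB.
have inlK x : x \in rS G -> (inl (vorbit G x) \in cover K) = (blk G P x \in K).
  move=> xS; apply/bigcupP/idP => [[B KB]|bK].
    by rewrite (blkE pP) ?(subsetP KP) // => /eqP->.
  by exists (blk G P x) => //; apply: mem_blk.
apply/setP=> -[O|N]; rewrite inE.
  apply/idP/orP => [OK|[/imsetP[_ /imsetP[x + ->] [->]]|/imsetP[]//]].
    have /inl_vertsP[x xS def] := subsetP coverS _ OK.
    left; apply: imset_f; rewrite def; apply: imset_f.
    by rewrite inE xS -inlK // -def.
  by rewrite inE => /andP[xS bK]; rewrite inlK.
apply/idP/orP => [NK|[/imsetP[]//|/imsetP[N' + [->]]]].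
  right; apply: imset_f; rewrite inE NK -inr_verts andbT.
  exact: subsetP coverS _ NK.
by rewrite inE => /andP[].
Qed.

Lemma q1_lq G P w : wf_rg G -> partition P (verts G) ->
  q1 Gam G P w =
  lq Gam (rS G) (rsg G) (ral G) (blk G P) P (fun B => #|B|) w.
Proof.
move=> wf pP; have lw := lwf_graph wf pP.
have eqadj : badj G P =2 ladj (rS G) (ral G) (blk G P) P.
  move=> B1 B2; rewrite /badj /ladj; have [PB1|//] := boolP (B1 \in P).
  have [PB2|//] := boolP (B2 \in P); apply: eq_existsb => x.
  by have [xS|//] := boolP (x \in _); rewrite !(blkE pP) ?(wf_ral wf).
have defC : comps G P = gcomps (ladj (rS G) (ral G) (blk G P) P) P.
  apply: eq_imset => B; apply/setP=> C; rewrite !inE.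
  by rewrite (eq_connect eqadj).
have term K : K \in comps G P ->
    q1conn Gam (subg G K) K w =
    lterm Gam (rS G) (rsg G) (ral G) (blk G P) (fun B => #|B|) w K.
  rewrite defC => /gcomps_sub KP; rewrite /q1conn /lterm /=.
  have defS : [set x in rS G | inl (vorbit G x) \in cover K]
      = fib (rS G) (blk G P) K.
    apply/setP=> x; rewrite !inE; have [xS|//] := boolP (x \in rS G).
    apply/bigcupP/idP => [[B KB]|bK].
      by rewrite (blkE pP) ?(subsetP KP) // => /eqP->.
    by exists (blk G P x) => //; apply: mem_blk.
  have -> : #|edges (subg G K)| = ned (ral G) (fib (rS G) (blk G P) K).
    by rewrite /edges /= defS.
  congr (_ * sumdeg _ (_ - _ + _ - _)).
  (* The dual keeps the isolated vertices, so the faces are the cycles of the dual rotation plus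
     those vertices, which is what [lface] computes. *)
  rewrite /lface (verts_cover wf pP KP) /faces card_verts /= defS.
  rewrite -[X in (X + _)%N]/(ncyc (fun x => rsg G (ral G x)) _).
  by lia.
(* In the connected case the only component is [P] itself, and [q1conn] of the whole graph is its
   single factor. *)
rewrite /q1 /lq -defC; case: ifP => [|_]; last exact: eq_bigr.
rewrite /connectedb => /cards1P[K defK].
rewrite defK big_set1.
have KP : K = P.
  have cK : K \in comps G P by rewrite defK set11.
  apply/setP=> B; apply/idP/idP => [|PB].
    by apply/subsetP; rewrite defC in cK; apply: gcomps_sub cK.
  have : [set C in P | connect (badj G P) B C] \in comps G P by apply: imset_f.
  by rewrite defK => /set1P <-; rewrite inE PB connect0.
rewrite KP /q1conn {term}.
have fibP : fib (rS G) (blk G P) P = rS G.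
  apply/setP=> x; rewrite inE; have [xS|//] := boolP (x \in rS G).
  exact: blk_mem.
rewrite /lterm /= fibP; congr (_ * sumdeg _ (_ - _ + _ - _)).
rewrite /lface (verts_cover wf pP (subxx P)) fibP /faces card_verts /=.
rewrite -[X in (X + _)%N]/(ncyc (fun x => rsg G (ral G x)) _).
suff -> : [set N in rI G | inr N \in cover P] = rI G by lia.
apply/setP=> N; rewrite inE (cover_partition pP) inr_verts.
by rewrite andbb.
Qed.

End Graphs.

(** * Deletion and states *)

Section Deletion.
Variable D : finType.
Implicit Types (G : rgraph D) (X : {set D}) (P : {set {set vtx D}}).

(** A cycle not inside [X] is determined by any dart it keeps. A cycle inside [X] becomes its own
    name, which differs from the old names since these contain no dart of [G]. *)
Lemma vtrans_inj G X : wf_rg G -> {in verts G &, injective (vtrans X)}.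
Proof.
move=> wf; have mixed O N : inl O \in verts G -> inr N \in verts G ->
    vtrans X (inl O) <> inr N.
  move=> /inl_vertsP[x xS ->]; rewrite inr_verts => IN /=.
  case: ifP => // _ [eqN].
  by move: (isolated_neq_vorbit wf IN xS); rewrite eqN eqxx.
move=> [O1|N1] [O2|N2] V1 V2; last by case=> ->.
- have [x xS def1] := inl_vertsP V1; have [y yS def2] := inl_vertsP V2.
  rewrite /=; case: ifPn => sub1; case: ifPn => // sub2 [] eqO; rewrite ?eqO //.
  have /subsetPn[z zO zX] := sub1.
  have : z \in O2 :\: X by rewrite -eqO inE zX.
  case/setDP; rewrite def2 => zO2 _; rewrite def1 in zO.
  by rewrite def1 (eq_vorbit wf xS zO) (eq_vorbit wf yS zO2).
- by move/(mixed _ _ V1 V2).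
- by move/esym/(mixed _ _ V2 V1).
Qed.

Lemma vorbit_del G X x : wf_rg G -> alpha_closed G X -> x \in rS G :\: X ->
  inl (vorbit (del G X) x) = vtrans X (inl (vorbit G x)).
Proof.
move=> wf [XS _] xQ; have /setDP[xS xX] := xQ; rewrite /=.
rewrite ifF; last by apply: contraNF xX => /subsetP-> //; apply: orb_refl.
rewrite vorbitE /= (orb_frst (wf_permutes wf)) ?subsetDl //.
by rewrite setIDA (setIidPl (vorbit_sub wf xS)).
Qed.

Lemma verts_del G X : wf_rg G -> alpha_closed G X ->
  verts (del G X) = vtrans X @: verts G.
Proof.
move=> wf cX; apply/setP=> v; apply/idP/imsetP => [|[[O|N] vG ->]].
- case: v => [O|N].
    case/inl_vertsP=> x xQ ->; rewrite vorbit_del //.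
    by exists (inl (vorbit G x)) => //; apply: inl_verts; case/setDP: xQ.
  rewrite inr_verts inE => /orP[IN|/imsetP[x + ->]].
    by exists (inr N) => //; rewrite inr_verts.
  rewrite inE => /andP[xS sub]; exists (inl (vorbit G x)); first exact: inl_verts.
  by rewrite /= sub.
- have [x xS def] := inl_vertsP vG; have [sub|/subsetPn[z zO zX]] := boolP (O \subset X).
    rewrite /= sub inr_verts inE; apply/orP; right.
    by apply/imsetP; exists x; rewrite // inE xS -def.
  have zS : z \in rS G by rewrite def in zO; apply: subsetP (vorbit_sub wf xS) _ zO.
  have zQ : z \in rS G :\: X by rewrite inE zX.
  rewrite def in zO *; rewrite (eq_vorbit wf xS zO) -vorbit_del //.
  exact: inl_verts.
- by rewrite /= inr_verts inE -inr_verts vG.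
Qed.

Lemma partition_del G X P : wf_rg G -> alpha_closed G X ->
  partition P (verts G) -> partition (tpart (vtrans X) P) (verts (del G X)).
Proof.
by move=> wf cX pP; rewrite verts_del //; apply/partition_imset_in/pP/vtrans_inj.
Qed.

Lemma blk_del G X P x : wf_rg G -> alpha_closed G X ->
  partition P (verts G) -> x \in rS G :\: X ->
  blk (del G X) (tpart (vtrans X) P) x = vtrans X @: blk G P x.
Proof.
move=> wf cX pP xQ; rewrite /blk vorbit_del //.
apply: pblock_imset_in pP _ _; first exact: vtrans_inj.
by apply: inl_verts; case/setDP: xQ.
Qed.

Lemma tweightE G X P (w : {set vtx D} -> nat) B : wf_rg G ->
  partition P (verts G) -> B \in P ->
  tweight (vtrans X) (verts G) w (vtrans X @: B) = w B.
Proof. by move=> wf pP PB; rewrite /tweight (preimset_in (vtrans_inj wf) pP). Qed.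

Variables (gT : finGroupType) (Gam : {group gT}).

Lemma q1_del G X P w : wf_rg G -> alpha_closed G X -> partition P (verts G) ->
  q1 Gam (del G X) (tpart (vtrans X) P) (tweight (vtrans X) (verts G) w) =
  lq Gam (rS G :\: X) (frst (rsg G) (rS G :\: X)) (ral G) (blk G P) P
     (fun B => #|B|) w.
Proof.
move=> wf cX pP; have wf' := wf_del wf cX; have pP' := partition_del wf cX pP.
have injP := imset_in_inj (@vtrans_inj G X wf) pP.
rewrite q1_lq //= (lq_congr _ (lwf_graph wf' pP') (fun _ _ => erefl _) (fun _ _ => erefl _)
  (fun x xQ => blk_del wf cX pP xQ) (fun _ _ => erefl _) (fun _ _ => erefl _)).
apply: lq_relabel => //.
- apply: lwf_frst (lwf_graph wf pP) _ _; first exact: subsetDl.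
  by move=> x; apply: alpha_closedD wf cX.
- move=> B PB; apply: card_in_imset => u v uB vB.
  have BG := subsetP (partitionS pP PB).
  exact: (vtrans_inj wf (BG _ uB) (BG _ vB)).
- by move=> B PB; apply: tweightE wf pP PB.
Qed.

Lemma edges_cover G (A : {set {set D}}) : wf_rg G -> A \subset edges G ->
  cover A \subset rS G /\ {in cover A, forall x, ral G x \in cover A}.
Proof.
move=> wf AE; split.
  apply/subsetP=> x /bigcupP[B AB xB]; have /imsetP[y yS def] := subsetP AE _ AB.
  by rewrite def in xB; case/set2P: xB => ->; rewrite ?(wf_ral wf).
move=> x /bigcupP[B AB xB]; have /imsetP[y yS def] := subsetP AE _ AB.
apply/bigcupP; exists B => //; rewrite def in xB *.
by case/set2P: xB => ->; rewrite ?(proj1 (wf_ralK wf yS)) !inE eqxx ?orbT.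
Qed.

(** The state [A] keeps the darts in [cover A]; its blocks can remain labelled by those of [G], so
    all states share one label set. *)
Lemma qG_lq G P w : wf_rg G -> partition P (verts G) ->
  qG Gam G P w = \sum_(A in powerset (edges G)) (-1) ^+ #|edges G :\: A| *
    lq Gam (cover A) (frst (rsg G) (cover A)) (ral G) (blk G P) P
      (fun B => #|B|) w.
Proof.
move=> wf pP; apply: eq_bigr => A; rewrite inE => AE; congr (_ * _).
have [cA aA] := edges_cover wf AE.
rewrite q1_del //; first by rewrite setDDr setDv set0U (setIidPr cA).
split=> [|x /setDP[xS xA]]; first exact: subsetDl.
rewrite inE (wf_ral wf) // andbT; apply: contra xA => /aA.
by rewrite (proj1 (wf_ralK wf xS)).
Qed.

Lemma alpha_closed_edge G h : wf_rg G -> h \in rS G ->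
  alpha_closed G (edge_of G h).
Proof.
move=> wf hS; split; first by apply/subsetP=> x /set2P[] ->; rewrite ?(wf_ral wf).
by move=> x /set2P[] ->; rewrite ?(proj1 (wf_ralK wf hS)) !inE eqxx ?orbT.
Qed.

Lemma edges_del G s I h : wf_rg G -> h \in rS G ->
  edges (RG (rS G :\: edge_of G h) s (ral G) I) = edges G :\ edge_of G h.
Proof.
move=> wf hS; apply/setP=> B; rewrite in_setD1; apply/imsetP/andP => [[x]|].
  case/setDP=> xS xe ->; split; last exact: imset_f.
  by apply: contraNneq xe => <-; rewrite /= set21.
case=> neq /imsetP[x xS def]; exists x => //; rewrite inE xS andbT.
apply: contra neq => xe; rewrite def /edge_of.
case/set2P: xe => -> //.
by rewrite (proj1 (wf_ralK wf hS)) setUC.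
Qed.

(** Sets containing [e] correspond to their remainders with the same complement; for sets avoiding
    [e] the complement has one more element, which gives the minus sign. *)
Lemma sum_powersetD1 (T : finType) (R : nzRingType) (E : {set T}) e
    (F : {set T} -> R) : e \in E ->
  \sum_(A in powerset E) (-1) ^+ #|E :\: A| * F A =
  \sum_(A in powerset (E :\ e)) (-1) ^+ #|(E :\ e) :\: A| * F (e |: A)
  - \sum_(A in powerset (E :\ e)) (-1) ^+ #|(E :\ e) :\: A| * F A.
Proof.
move=> eE; rewrite (bigID (fun A : {set T} => e \in A)) /=; congr (_ + _).
  rewrite (reindex_onto (fun A : {set T} => e |: A) (fun A => A :\ e)) /=; last first.
    by move=> A /andP[_ eA]; rewrite setD1K.
  apply: eq_big => [A|A /andP[/andP[]]]; last first.
    rewrite !inE => AE _ _; congr (_ ^+ #|pred_of_set _| * _).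
    by rewrite setDDl.
  rewrite !inE eqxx andbT subsetD1 subUset sub1set eE /= andbC.
  have [eA|eA] := boolP (e \in A).
    rewrite andbF; apply/negbTE/negP=> /andP[/eqP def _].
    by move: eA; rewrite -def !inE eqxx.
  by rewrite setU1K // eqxx andbT.
rewrite -sumrN; apply: eq_big => [A|A /andP[]].
  by rewrite !inE subsetD1.
rewrite inE => AE eA; rewrite -mulNr; congr (_ * _).
suff -> : #|E :\: A| = #|E :\ e :\: A|.+1 by rewrite exprS mulN1r.
by rewrite (cardsD1 e (E :\: A)) inE eA eE add1n !setDDl setUC.
Qed.

(** The states of the deletion are the states of [G] avoiding [e]: two successive first returns are
    one, and [vtrans e] renames the blocks injectively. *)
Lemma qG_del G P w h : wf_rg G -> partition P (verts G) -> h \in rS G ->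
  let e := edge_of G h in
  qG Gam (del G e) (tpart (vtrans e) P) (tweight (vtrans e) (verts G) w) =
  \sum_(A in powerset (edges G :\ e)) (-1) ^+ #|(edges G :\ e) :\: A| *
    lq Gam (cover A) (frst (rsg G) (cover A)) (ral G) (blk G P) P
      (fun B => #|B|) w.
Proof.
move=> wf pP hS e; have ce := alpha_closed_edge wf hS.
have wf' := wf_del wf ce; have pP' := partition_del wf ce pP.
rewrite qG_lq // edges_del //; apply: eq_bigr => A.
rewrite inE => AE; congr (_ * _).
have AE' : A \subset edges (del G e) by rewrite edges_del.
have [cA aA] := edges_cover wf' AE'.
have cAS : cover A \subset rS G by apply: subset_trans cA (subsetDl _ _).
have lw' : lwf (cover A) (frst (rsg (del G e)) (cover A)) (ral G)
    (blk (del G e) (tpart (vtrans e) P)) (tpart (vtrans e) P).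
  exact: lwf_frst (lwf_graph wf' pP') _ _.
have pQ : permutes (rsg G) (rS G) := wf_permutes wf.
have s_eq : {in cover A, frst (rsg (del G e)) (cover A) =1 frst (rsg G) (cover A)}.
  by apply: (frst_frst pQ) => //; apply: subsetDl.
have b_eq : {in cover A, blk (del G e) (tpart (vtrans e) P) =1
    fun x => vtrans e @: blk G P x}.
  by move=> x xA; apply: blk_del => //; apply: (subsetP cA).
rewrite (lq_congr _ lw' s_eq (fun _ _ => erefl _) b_eq (fun _ _ => erefl _) (fun _ _ => erefl _)).
apply: lq_relabel => //.
- exact: lwf_frst (lwf_graph wf pP) cAS aA.
- exact: imset_in_inj (vtrans_inj wf) pP.
- move=> B PB; apply: card_in_imset => u v uB vB.
  have BG := subsetP (partitionS pP PB).
  exact: (vtrans_inj wf (BG _ uB) (BG _ vB)).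
- by move=> B PB; apply: tweightE wf pP PB.
Qed.

End Deletion.

(** * Contraction in a packaged ribbon graph *)

(** A set of size [v] loses [b.+1] ends and gains [n] new elements, with [b] equal to 1 for a
    non-loop and 0 for a loop. One direction finds the number of new vertices, the other the size of
    the merged block. *)
Lemma replaced_count (v n b : nat) : (b < v)%N ->
  (v - b.+1 + n + b.*2 = v.+1 <-> n + b = 2)%N.
Proof. by lia. Qed.

Section GraphContraction.
Variables (D : finType) (G : rgraph D) (P : {set {set vtx D}}) (h : D).
Hypotheses (wf : wf_rg G) (pP : partition P (verts G)) (hS : h \in rS G).
Let y := ral G h.
Let e := edge_of G h.
Let G' := con G e.
Let Q := rS G :\: e.
Let g := twist (rsg G) h y.
Let va : vtx D := inl (vorbit G h).
Let vb : vtx D := inl (vorbit G y).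
Let Ba := pblock P va.
Let Bb := pblock P vb.
Let M := [set Ba; Bb].
Let N := verts G' :\: verts G.
Let B' := ((Ba :|: Bb) :\: [set va; vb]) :|: N.
Let merge B := if B \in M then B' else B.
Let P' := (P :\: [set Ba; Bb]) :|: [set B'].
Let nl : bool := y \notin vorbit G h.

Let yS : y \in rS G. Proof. exact: wf_ral. Qed.
Let ce : alpha_closed (dual G) e. Proof. exact: alpha_closed_edge (wf_dual wf) hS. Qed.
Let ps : permutes (rsg G) (rS G). Proof. exact: wf_permutes. Qed.
Let pg : permutes g (rS G). Proof. exact: permutes_twist. Qed.

Lemma wf_con : wf_rg G'.
Proof. exact/wf_dual/(wf_del (wf_dual wf) ce). Qed.

(** Contraction deletes in the dual, so its rotation is the first return of [rsg G \o ral G]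
    preceded by [ral G]; by [frst_twist] the two involutions cancel. *)
Lemma rsg_con : {in Q, rsg G' =1 frst g Q}.
Proof.
move=> z zQ; have aK t : t \in rS G -> ral G (ral G t) = t.
  by case/(wf_ralK wf).
have azQ : ral G z \in Q by apply: (alpha_closedD (wf_dual wf) ce zQ).
have /= -> := frst_twist ps (wf_ral wf) aK hS azQ.
by rewrite aK //; case/setDP: zQ.
Qed.

Lemma card_verts_con : (#|verts G'| + nl.*2 = #|verts G|.+1)%N.
Proof.
have neq : h != y by rewrite eq_sym; case: (wf_ralK wf hS).
have ct : (ncyc g (rS G) + nl.*2 = (ncyc (rsg G) (rS G)).+1)%N.
  exact: ncyc_twist ps hS yS neq.
rewrite !card_verts /=.
have -> : ncyc (rsg G') (rS G') = ncyc (frst g Q) Q.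
  by apply: ncyc_congr rsg_con _ _ => //; case: (wf_permutes wf_con).
have := ncyc_frst pg (subsetDl (rS G) e); rewrite -/Q => cg.
(* The added isolated vertices are the dual cycles contained in [e]. They are also the cycles of [g]
   contained in [e], as the two maps agree there. *)
have -> : #|rI G'| = (#|rI G| + #|dead_orbits g (rS G) Q|)%N.
  pose f z := rsg G (ral G z).
  have pf : permutes f (rS G) := wf_permutes (wf_dual wf).
  have <- : dead_orbits f (rS G) Q = dead_orbits g (rS G) Q.
    apply: dead_orbits_congr; [by case: pf | by case: pg |].
    move=> z; rewrite !inE => /andP[+ zS]; rewrite zS andbT negbK /f /g /twist.
    by case/orP=> /eqP->; rewrite ?tpermL ?tpermR ?(proj1 (wf_ralK wf hS)).
  rewrite /= cardsU (_ : _ :&: _ = set0) ?cards0 ?subn0; last first.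
    apply/setP=> O; rewrite in_set0 inE; apply/negP=> /andP[IO /imsetP[x + def]].
    rewrite inE => /andP[xS _].
    by move: (isolated_neq_vorbit (wf_dual wf) IO xS); rewrite def eqxx.
  congr (_ + _)%N; congr #|(_ : {set {set D}})|; apply/setP=> O.
  rewrite inE; apply/imsetP/andP => [[x]|[/imsetP[x xS ->] dis]].
    rewrite inE => /andP[xS sub] ->; split; first exact: imset_f.
    by apply/pred0P=> z /=; apply/negP=> /andP[/(subsetP sub) ze]; rewrite inE ze.
  exists x => //; rewrite inE xS /=; apply/subsetP=> z zO.
  move: (disjointFr dis zO); rewrite inE.
  by rewrite (subsetP (vorbit_sub (wf_dual wf) xS) _ zO) andbT => /negbFE.
by move: ct; rewrite cg => ct; rewrite -addSn -ct -!addnA [X in (_ + X)%N = _]addnC -addnA.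
Qed.

Let orb_off x : x \in rS G -> inl (vorbit G x) != va -> inl (vorbit G x) != vb ->
  [disjoint vorbit G x & e].
Proof.
move=> xS na nb; apply/pred0P=> z /=; apply/negP=> /andP[zO ze].
have eqO := eq_vorbit wf xS zO; rewrite eqO in na nb.
by case/set2P: ze => def; rewrite def eqxx in na nb.
Qed.

Let vorbit_off x : x \in rS G -> [disjoint vorbit G x & e] ->
  vorbit G' x = vorbit G x.
Proof.
move=> xS dis; apply/esym/(@orb_congr _ _ _ (vorbit G x)); last exact: orb_refl.
  move=> z zO; have zS := subsetP (vorbit_sub wf xS) _ zO.
  have zQ : z \in Q by rewrite inE zS (disjointFr dis zO).
  rewrite rsg_con //; apply/esym/(frst_eq pg) => //; first exact: subsetDl.
  have gz : g z = rsg G z.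
    rewrite /g /twist tpermD //; apply: contraTneq zO => <-;
      by rewrite (disjointFl dis) // !inE eqxx ?orbT.
  rewrite -gz; apply: hits_here; rewrite gz inE; case: ps => _ ->//.
  rewrite andbT (disjointFr dis) // inE; move: zO; rewrite inE => /connect_trans.
  by apply; apply: fconnect1.
by move=> z; rewrite !inE => /connect_trans->//; apply: fconnect1.
Qed.

(** If this were an old vertex, it would be the whole cycle of [x] in [G], which contains a dart of
    [e]; but [G'] has no such dart. *)
Let vorbit_on x : x \in Q -> ~~ [disjoint vorbit G x & e] ->
  inl (vorbit G' x) \in N.
Proof.
move=> xQ ndis; have xS : x \in rS G by case/setDP: xQ.
rewrite inE inl_verts // andbT; apply/negP=> /inl_vertsP[t tS def].
have xt : x \in vorbit G t by rewrite -def orb_refl.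
case/negP: ndis; rewrite -(eq_vorbit wf tS xt) -def.
apply/pred0P=> z /=; apply/negP=> /andP[/(subsetP (vorbit_sub wf_con xQ))].
by case/setDP=> _ /negbTE->.
Qed.

Let verts_keep : verts G :\: [set va; vb] \subset verts G'.
Proof.
apply/subsetP=> -[O|I]; rewrite !inE negb_or => /andP[/andP[na nb]].
  rewrite -[_ || _]in_setU => /inl_vertsP[x xS def]; rewrite def in na nb *.
  have dis := orb_off xS na nb.
  rewrite -(vorbit_off xS dis) -[_ || _]in_setU; apply: inl_verts.
  by rewrite inE xS (disjointFr dis (orb_refl _ _)).
rewrite -[_ || _]in_setU inr_verts => IN.
by rewrite -[_ || _]in_setU inr_verts inE IN.
Qed.

Let verts_gone v : v \in [set va; vb] -> v \notin verts G'.
Proof.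
have gone x : x \in e -> inl (vorbit G x) \notin verts G'.
  move=> xe; apply/negP=> /inl_vertsP[z zQ def].
  have := subsetP (vorbit_sub wf_con zQ) x; rewrite -def orb_refl => /(_ isT).
  by rewrite inE xe.
by case/set2P=> ->; apply: gone; rewrite !inE eqxx ?orbT.
Qed.

Let va_in : va \in verts G. Proof. exact: inl_verts. Qed.
Let vb_in : vb \in verts G. Proof. exact: inl_verts. Qed.

Let card_vab : #|[set va; vb]| = nl.+1.
Proof.
rewrite cards2; congr (nat_of_bool _).+1; rewrite /nl -(eq_orb ps) //.
Qed.

Let vertsE : verts G' = (verts G :\: [set va; vb]) :|: N.
Proof.
apply/setP=> v; rewrite in_setU !in_setD.
have [vG|vG] := boolP (v \in verts G); rewrite ?andbT ?andbF //=.
rewrite orbF; have [/verts_gone/negbTE->//|vn] := boolP (v \in [set _; _]).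
by apply: (subsetP verts_keep); rewrite inE vn.
Qed.

(** The new vertices are counted without being identified: all old vertices except the ends of [e]
    persist, so the total number of vertices determines [#|N|]. *)
Let card_new : (#|N| + nl = 2)%N.
Proof.
have := card_verts_con; rewrite vertsE cardsU.
rewrite (_ : _ :&: N = set0) ?cards0 ?subn0; last first.
  apply/setP=> v; rewrite in_set0 in_setI; apply/negP.
  by case/andP=> /setDP[vG _] /setDP[_]; rewrite vG.
have sub : [set va; vb] \subset verts G by apply/subsetP=> v /set2P[] ->.
have := subset_leq_card sub; rewrite cardsD (setIidPr sub) card_vab.
by move=> ltb /(replaced_count _ ltb).
Qed.

Let card_new_gt0 : (0 < #|N|)%N.
Proof. by move: card_new; case: #|N| => //; case: nl. Qed.

Let trivP : trivIset P. Proof. exact: partition_trivIset pP. Qed.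
Let BaP : Ba \in P. Proof. exact: (blk_mem pP). Qed.
Let BbP : Bb \in P. Proof. exact: (blk_mem pP). Qed.
Let BG B : B \in P -> B \subset verts G. Proof. exact: partitionS. Qed.

(** The merged block contains a new vertex. Hence the test in the weight function of [mrule] singles
    out this block and no old one. *)
Let new_out B : B \in P -> B != B'.
Proof.
move=> PB; have := card_new_gt0.
case/card_gt0P=> v vN; apply: contraTneq (vN) => def.
have : v \in B by rewrite def inE vN orbT.
by move/(subsetP (BG PB)) => vG; rewrite inE vG.
Qed.

Lemma contracted_blocks : P' = merge @: P.
Proof.
apply/setP=> B; rewrite in_setU in_setD in_set1; apply/orP/imsetP.
  case=> [/andP[nM PB]|/eqP->]; first by exists B; rewrite // /merge (negbTE nM).
  by exists Ba; rewrite // /merge set21.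
case=> C PC ->; rewrite /merge; have [CM|CM] := boolP (C \in M); first by right.
by left; rewrite CM.
Qed.

Let coverM : cover M = Ba :|: Bb.
Proof. by rewrite /cover bigcup_setU !big_set1. Qed.

Lemma partition_con : partition P' (verts G').
Proof.
have BaG := BG BaP; have BbG := BG BbP.
have vaB : va \in Ba by apply: (mem_blk pP).
have vbB : vb \in Bb by apply: (mem_blk pP).
have old B v : B \in P -> B \notin M -> v \in B -> v \notin Ba :|: Bb.
  move=> PB BM vB; apply: contra BM => /setUP[] vM.
    by rewrite -(def_pblock trivP PB vB) (def_pblock trivP BaP vM) set21.
  by rewrite -(def_pblock trivP PB vB) (def_pblock trivP BbP vM) set22.
have dis B : B \in P -> B \notin M -> [disjoint B & B'].
  move=> PB BM; apply/pred0P=> v /=; apply/negP=> /andP[vB].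
  case/setUP=> [/setDP[vab _]|/setDP[_ /negP[]]].
    by case/negP: (old B v PB BM vB).
  exact: subsetP (BG PB) _ vB.
apply/and3P; split.
- apply/eqP; rewrite vertsE; apply/setP=> v; apply/bigcupP/idP.
    case=> B; rewrite in_setU in_set1 => /orP[/setDP[PB BM]|/eqP-> vB'].
      move=> vB; rewrite in_setU in_setD (subsetP (BG PB) _ vB) andbT.
      apply/orP; left; apply: contra (old B v PB BM vB).
      by case/set2P=> ->; rewrite inE ?vaB ?vbB ?orbT.
    case/setUP: vB' => [/setDP[/setUP vab nv]|vN]; last by rewrite inE vN orbT.
    rewrite in_setU in_setD nv /=; apply/orP; left.
    by case: vab; [apply: (subsetP BaG) | apply: (subsetP BbG)].
  case/setUP=> [/setDP[vG nv]|vN]; last first.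
    by exists B'; rewrite !in_setU ?in_set1 ?eqxx ?vN orbT.
  have vc : v \in cover P by rewrite (cover_partition pP).
  have [BM|BM] := boolP (pblock P v \in M); last first.
    exists (pblock P v); last by rewrite mem_pblock.
    by rewrite in_setU in_setD BM pblock_mem.
  exists B'; first by rewrite in_setU in_set1 eqxx orbT.
  rewrite in_setU in_setD nv -coverM /=; apply/orP; left; apply/bigcupP.
  by exists (pblock P v); rewrite ?mem_pblock.
- apply/trivIsetP=> B C; rewrite !in_setU !in_set1.
  case/orP=> [/setDP[PB BM]|/eqP->] /orP[/setDP[PC CM]|/eqP->].
  + exact: (trivIsetP trivP).
  + by move=> _; apply: dis.
  + by move=> _; rewrite disjoint_sym; apply: dis.
  by rewrite eqxx.
rewrite in_setU in_setD (partition0 pP) andbF /= in_set1.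
have := card_new_gt0.
case/card_gt0P=> v vN; apply/negP=> /eqP/setP/(_ v).
by rewrite in_set0 in_setU vN orbT.
Qed.

(** A vertex that misses [e] persists in its block. A vertex that meets [e] is an end of [e], so its
    block lies in [M] and what remains of it is a new vertex in [B']. *)
Lemma blk_con x : x \in Q -> blk G' P' x = merge (blk G P x).
Proof.
move=> xQ; have /setDP[xS xe] := xQ.
apply: def_pblock; first exact: partition_trivIset partition_con.
  by rewrite contracted_blocks; apply: imset_f; apply: (blk_mem pP).
have [dis|ndis] := boolP [disjoint vorbit G x & e]; last first.
  have -> : merge (blk G P x) = B'; last by rewrite inE vorbit_on ?orbT.
  rewrite /merge; case: ifP => // /negP[].
  case/pred0Pn: ndis => z /andP[/= zO ze].
  rewrite /blk (eq_vorbit wf xS zO).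
  by case/set2P: ze => ->; rewrite ?set21 ?set22.
rewrite vorbit_off // /merge; case: ifP => BM; last exact: (mem_blk pP).
rewrite in_setU; apply/orP; left; rewrite in_setD -coverM; apply/andP; split.
  have nx z : z \in e -> inl (vorbit G x) <> inl (vorbit G z) :> vtx D.
    by move=> ze [eqO]; move: (disjointFl dis ze); rewrite eqO orb_refl.
  by apply/negP=> /set2P[]; apply: nx; rewrite ?set21 ?set22.
by apply/bigcupP; exists (blk G P x) => //; apply: (mem_blk pP).
Qed.

Lemma card_merged : (#|B'| + nl.*2 = (\sum_(B in M) #|B|).+1)%N.
Proof.
have MP : M \subset P by apply/subsetP=> B /set2P[] ->.
have /eqnP -> := trivIsetS MP trivP; rewrite coverM.
have vaB : va \in Ba by apply: (mem_blk pP).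
have vbB : vb \in Bb by apply: (mem_blk pP).
have sub : [set va; vb] \subset Ba :|: Bb.
  by apply/subsetP=> v /set2P[] ->; rewrite inE ?vaB ?vbB ?orbT.
rewrite /B' cardsU (_ : _ :&: N = set0) ?cards0 ?subn0; last first.
  apply/setP=> v; rewrite in_set0 in_setI in_setD; apply/negP.
  case/andP=> /andP[_ vab] /setDP[_ /negP[]]; case/setUP: vab.
    exact/subsetP/BG.
  exact/subsetP/BG.
have := subset_leq_card sub; have := card_new.
rewrite cardsD (setIidPr sub) card_vab.
by move=> eq2 ltb; apply/(replaced_count _ ltb).
Qed.

Variables (gT : finGroupType) (Gam : {group gT}) (w : {set vtx D} -> nat).
Let r := mrule P w va vb N.

(** The state [A] of [G/e] is matched with the state [e |: A] of [G], and [lq_contract] is applied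
    to each pair with [merge] as the map of blocks. *)
Lemma qG_con :
  ordG Gam ^ (2%:Z - #|M|%:Z) * qG Gam G' r.1 r.2 =
  \sum_(A in powerset (edges G :\ e)) (-1) ^+ #|(edges G :\ e) :\: A| *
    lq Gam (cover (e |: A)) (frst (rsg G) (cover (e |: A))) (ral G)
      (blk G P) P (fun B => #|B|) w.
Proof.
have wf' := wf_con; have pP' : partition r.1 (verts G') := partition_con.
have edges' : edges G' = edges G :\ e by exact: (edges_del _ _ wf hS).
have eE : e \in edges G by apply: imset_f.
rewrite qG_lq // mulr_sumr edges'; apply: eq_bigr => A.
rewrite inE => AE; rewrite mulrCA; congr (_ * _).
have AE' : A \subset edges G' by rewrite edges'.
have [cA aA] := edges_cover wf' AE'.
set S := cover (e |: A).
have AE2 : e |: A \subset edges G.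
  by rewrite subUset sub1set eE (subset_trans AE) ?subD1set.
have [cS aS] := edges_cover wf AE2.
have eS : e \subset S by apply: (bigcup_max e) => //; apply: setU11.
have SE : S :\: e = cover A.
  rewrite /S /cover bigcup_setU big_set1 setDUl setDv set0U.
  by apply/setDidPl; rewrite disjoint_sym disjoints_subset;
     apply/subsetP=> x xe; rewrite inE; apply: contraL xe => /(subsetP cA);
     case/setDP.
have lw := lwf_frst (lwf_graph wf pP) cS aS.
have hSS : h \in S by apply: (subsetP eS); rewrite set21.
have ySS : y \in S by apply: (subsetP eS); rewrite set22.
rewrite (lq_contract Gam (h := merge) (n' := fun B => #|B|) (w' := r.2) lw hSS) //.
- rewrite -[ral G h]/y -/M; congr (_ * _).
  rewrite -[[set h; y]]/e SE -contracted_blocks.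
  apply: lq_congr => //.
  + exact: lwf_frst (lwf_graph wf' pP') cA aA.
  + move=> x xA; have cAQ : cover A \subset Q by [].
    have QS : Q \subset rS G by apply: subsetDl.
    (* Contracting and then restricting gives the first return of [g] to [cover A]; it is computed
       again through [S], as restricting comes first on the other side. *)
    rewrite (frst_congr (wf_permutes wf') cAQ rsg_con) //.
    rewrite (frst_frst pg QS cAQ) //.
    have AS : cover A \subset S by rewrite -SE subsetDl.
    rewrite -(frst_frst pg cS AS) //.
    apply: (frst_congr (permutes_frst pg cS) AS) => // z zS.
    have zR := subsetP cS _ zS.
    (* Twisting commutes with the first return to [S]: the transposition exchanges two darts of [S],
       so it affects only the start of each walk. *)
    apply: (frst_eq pg cS zS).
    have tS : tperm h y z \in S by apply: tperm_in.
    apply: (@hits_congr _ (rsg G) g (rS G) S (tperm h y z) z) => //.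
    - by case: ps.
    - move=> t /setDP[_ tnS]; rewrite /g /twist tpermD //.
        by apply: contraNneq tnS => <-.
      by apply: contraNneq tnS => <-.
    - by case: ps => _; apply; apply: (subsetP cS).
    exact: (frst_hits ps).
  by move=> x xA; apply: blk_con; apply: (subsetP cA).
- by rewrite /merge set21 set22.
- move=> B C PB PC; rewrite /merge; case: ifPn => BM; case: ifPn => CM eqB.
  + by right; apply/andP.
  + by case/eqP: (new_out PC); rewrite eqB.
  + by case/eqP: (new_out PB); rewrite eqB.
  by left.
- by move=> B PB BM; rewrite /merge (negbTE BM).
- by move=> B PB BM; rewrite /merge (negbTE BM) /r /= (negbTE (new_out PB)).
(* Being a loop does not depend on the state, since first return maps preserve connectedness. *)
- rewrite -[ral G h]/y -/Ba /merge set21 -card_merged; congr (_ + _)%N.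
  congr (nat_of_bool _).*2; rewrite inE (fconnect_frst ps) // /nl inE.
  by [].
rewrite -[ral G h]/y -/M /merge set21 /r /= eqxx.
rewrite -/Ba -/Bb; case: (altP (Ba =P Bb)) => eqB.
  by rewrite /M -eqB setUid big_set1 cards1 addn1.
by rewrite /M cards2 eqB big_setU1 ?inE //= big_set1 addn2.
Qed.

End GraphContraction.

(** * Recursion and duality *)

Section Recursion.
Variables (D : finType) (gT : finGroupType) (Gam : {group gT}).
Implicit Types (G : rgraph D) (P : {set {set vtx D}}) (w : {set vtx D} -> nat).

Lemma card_ends_blocks G P h : wf_rg G -> partition P (verts G) ->
  h \in rS G ->
  #|[set B in P | (inl (vorbit G h) \in B) || (inl (vorbit G (ral G h)) \in B)]|
  = #|[set blk G P h; blk G P (ral G h)]|.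
Proof.
move=> wf pP hS; have yS := wf_ral wf hS; congr #|(_ : {set _})|.
apply/setP=> B; rewrite inE in_set2 ![B == _]eq_sym.
have [PB|nPB] := boolP (B \in P); first by rewrite !(blkE pP).
by apply/esym/norP; split; apply: contraNneq nPB => <-; apply: blk_mem pP _.
Qed.

Lemma qG_rec G P w h : wf_rg G -> partition P (verts G) -> h \in rS G ->
  let e := edge_of G h in
  let r := mrule P w (inl (vorbit G h)) (inl (vorbit G (ral G h)))
                 (verts (con G e) :\: verts G) in
  qG Gam G P w =
  ordG Gam ^ (2%:Z - #|[set B in P | (inl (vorbit G h) \in B)
                          || (inl (vorbit G (ral G h)) \in B)]|%:Z) *
    qG Gam (con G e) r.1 r.2
  - qG Gam (del G e) (tpart (vtrans e) P) (tweight (vtrans e) (verts G) w).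
Proof.
move=> wf pP hS e r; rewrite card_ends_blocks // /r qG_con // qG_del // qG_lq //.
by apply: sum_powersetD1; apply: imset_f.
Qed.

(** Only the empty state occurs, and without darts every block is a component by itself. *)
Lemma qG_edgeless G P w : wf_rg G -> partition P (verts G) ->
  edges G = set0 ->
  qG Gam G P w =
  \prod_(B in P) (ordG Gam ^ (-1) * sumdeg Gam (1 + #|B|%:Z - (w B)%:Z)).
Proof.
move=> wf pP E0; rewrite qG_lq // E0 powerset0 big_set1 setD0 cards0 mul1r.
rewrite /cover big_set0 /lq.
have noadj B C : connect (ladj set0 (ral G) (blk G P) P) B C = (C == B).
  apply/idP/eqP => [/connectP[[|A p] /= + ->] //|->]; last exact: connect0.
  by case/andP=> /and3P[_ _ /existsP[x]]; rewrite inE.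
have -> : gcomps (ladj set0 (ral G) (blk G P) P) P = [set [set B] | B in P].
  apply: eq_in_imset => B PB; apply/setP=> C; rewrite in_set1 inE noadj.
  by case: eqP => [->|_]; rewrite ?PB ?andbF.
rewrite big_imset /=; last by move=> B C _ _; apply: set1_inj.
apply: eq_bigr => B PB; rewrite /lterm (_ : fib _ _ _ = set0); last first.
  by apply/setP=> x; rewrite !inE.
rewrite /lface /ned /ncyc !imset0 !cards0 cards1 !big_set1.
by congr (_ ^ _ * sumdeg _ _); lia.
Qed.

Lemma q1_eqrg G1 G2 P w : wf_rg G1 -> wf_rg G2 -> eqrg G1 G2 ->
  partition P (verts G1) -> q1 Gam G1 P w = q1 Gam G2 P w.
Proof.
move=> wf1 wf2 eqG pP; have [eS eqs eqa _] := eqG.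
have pP2 : partition P (verts G2) by rewrite -(eqrg_verts wf1 eqG).
rewrite !q1_lq // -eS; apply: lq_congr => //; first exact: lwf_graph.
by move=> x xS; rewrite /blk (eqrg_vorbit wf1 eqG).
Qed.

Lemma wf_eqrg G1 G2 : wf_rg G1 -> eqrg G1 G2 -> wf_rg G2.
Proof.
move=> [[injs aS aK NI tI] sS] [eS eqs eqa eI].
split; rewrite -eS -?eI; last by move=> x xS; rewrite -eqs ?sS.
split=> //; first by apply: (proj1 (permutes_eq eqs _)).
  by move=> x xS; rewrite -eqa ?aS.
by move=> x xS; rewrite -!eqa ?aS //; apply: aK.
Qed.

Lemma edges_eqrg G1 G2 : eqrg G1 G2 -> edges G1 = edges G2.
Proof.
by case=> eS _ eqa _; rewrite /edges -eS; apply: eq_in_imset => x /eqa->.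
Qed.

Lemma qG_eqrg G1 G2 P w : wf_rg G1 -> eqrg G1 G2 ->
  partition P (verts G1) -> qG Gam G1 P w = qG Gam G2 P w.
Proof.
move=> wf1 eqG pP; have [eS eqs eqa _] := eqG.
have wf2 := wf_eqrg wf1 eqG.
have pP2 : partition P (verts G2) by rewrite -(eqrg_verts wf1 eqG).
rewrite !qG_lq // -(edges_eqrg eqG); apply: eq_bigr => A.
rewrite inE => /(edges_cover wf1)[cA aA]; congr (_ * _); have cS := subsetP cA.
apply: lq_congr => //; first exact: lwf_frst (lwf_graph wf1 pP) cA aA.
- exact: frst_congr (wf_permutes wf1) cA eqs.
- by move=> x /cS/eqa.
by move=> x /cS xS; rewrite /blk (eqrg_vorbit wf1 eqG).
Qed.

Lemma p1_dual G P w : wf_rg G -> p1 Gam G P w = q1 Gam (dual G) P w.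
Proof.
move=> wf; rewrite /p1 /q1; case: ifP => // _.
rewrite /p1conn /q1conn /faces.
by rewrite (eqrg_verts (wf_dual (wf_dual wf)) (eqrg_dualK wf)).
Qed.

(** Contracting the complement of [A] is deleting it in the dual, so the summands agree up to a
    double dual. *)
Lemma pG_dual G P w : wf_rg G -> partition P (faces G) ->
  pG_ Gam G P w = qG Gam (dual G) P w.
Proof.
move=> wf pP; apply: eq_bigr => A; rewrite inE => AE; congr (_ * _).
have wf' := wf_dual wf; have [cA aA] := edges_cover wf AE.
have cX : alpha_closed (dual G) (rS G :\: cover A).
  split=> [|x /setDP[xS xA]]; first exact: subsetDl.
  rewrite inE /= (wf_ral wf) // andbT; apply: contra xA => /aA.
  by rewrite (proj1 (wf_ralK wf xS)).
have wfd := wf_del wf' cX.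
rewrite p1_dual; last exact: wf_dual.
have eqd := eqrg_dualK wfd.
apply: q1_eqrg => //; first exact/wf_dual/wf_dual.
rewrite (eqrg_verts (wf_dual (wf_dual wfd)) eqd).
exact: partition_del.
Qed.

End Recursion.

(** * The recursion for p *)

Section DualRecursion.
Variables (D : finType) (gT : finGroupType) (Gam : {group gT}).
Implicit Types (G : rgraph D) (P : {set {set vtx D}}) (w : {set vtx D} -> nat).

Lemma pG_rec G P w h : wf_rg G -> partition P (faces G) -> h \in rS G ->
  let e := edge_of G h in
  let r := mrule P w (inl (forbit G h)) (inl (forbit G (ral G h)))
                 (faces (del G e) :\: faces G) in
  pG_ Gam G P w =
  ordG Gam ^ (2%:Z - #|[set B in P | (inl (forbit G h) \in B)
                          || (inl (forbit G (ral G h)) \in B)]|%:Z) *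
    pG_ Gam (del G e) r.1 r.2
  - pG_ Gam (con G e) (tpart (vtrans e) P) (tweight (vtrans e) (faces G) w).
Proof.
move=> wf pP hS e r; have wf' := wf_dual wf.
have ce : alpha_closed G e := alpha_closed_edge wf hS.
(* The contraction of the dual is the dual of the deletion, because the definition of [con] passes
   through the double dual of [G]. *)
have eqC : eqrg (con (dual G) e) (dual (del G e)).
  apply/eqrg_dual/eqrg_del/eqrg_dualK => //; last exact: wf_dual.
  exact: wf_del (wf_dual wf') ce.
have wfC : wf_rg (con (dual G) e) := wf_con wf' hS.
have pr := partition_con wf' pP hS.
have vC := eqrg_verts wfC eqC.
have -> := pG_dual Gam w wf pP.
have -> := qG_rec Gam w wf' pP hS.
have -> := qG_eqrg Gam (mrule P w _ _ _).2 wfC eqC pr.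
rewrite vC in pr *.
have -> := pG_dual Gam r.2 (wf_del wf ce) pr.
have wfd : wf_rg (del (dual G) e) := wf_del wf' ce.
have eqd := eqrg_dualK wfd; have wfdd := wf_dual (wf_dual wfd).
have pd : partition (tpart (vtrans e) P) (verts (dual (con G e))).
  by rewrite (eqrg_verts wfdd eqd); apply: partition_del.
congr (_ - _).
have -> := pG_dual Gam (tweight (vtrans e) (faces G) w) (wf_dual wfd) pd.
exact/esym/qG_eqrg.
Qed.

End DualRecursion.

Theorem theorem5p6 (D : finType) (P : pkg D) (gT : finGroupType) (Gam : {group gT}) :
  wf_pkg P ->
  [/\ (forall h, h \in rS (pG P) ->
         qG Gam (pG P) (pV P) (pwV P) =
         ordG Gam ^ (2%:Z - (mu_e P h)%:Z) *
           qG Gam (pG (pcon P h)) (pV (pcon P h)) (pwV (pcon P h))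
         - qG Gam (pG (pdel P h)) (pV (pdel P h)) (pwV (pdel P h))),
      (edges (pG P) = set0 ->
         qG Gam (pG P) (pV P) (pwV P) =
         \prod_(B in pV P)
            (ordG Gam ^ (-1) * sumdeg Gam (1 + #|B|%:Z - (pwV P B)%:Z))),
      (forall h, h \in rS (pG P) ->
         pG_ Gam (pG P) (pF P) (pwF P) =
         ordG Gam ^ (2%:Z - (eta_e P h)%:Z) *
           pG_ Gam (pG (pdel P h)) (pF (pdel P h)) (pwF (pdel P h))
         - pG_ Gam (pG (pcon P h)) (pF (pcon P h)) (pwF (pcon P h)))
    & (edges (pG P) = set0 ->
         pG_ Gam (pG P) (pF P) (pwF P) =
         \prod_(B in pF P)
            (ordG Gam ^ (-1) * sumdeg Gam (1 + #|B|%:Z - (pwF P B)%:Z)))].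
Proof.
case=> wf pV_ pF_; split=> [h hS|E0|h hS|E0].
- exact: qG_rec.
- exact: qG_edgeless.
- exact: pG_rec.
by rewrite pG_dual // qG_edgeless //; apply: wf_dual.
Qed.
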